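(* Let $R$ be a commutative noetherian ring, let $C$ be a semidualizing $R$-module, and let $M$ be an $R$-module. (a) For an integer $n\geq 0$, one has $\mathcal{F}_C\text{-}\operatorname{pd}_R(M)\leq n$ if and only if there is an exact sequence $0\to L_n\to\cdots\to L_0\to M\to 0$ such that each $L_i\in\mathcal{F}_C(R)$. (b) $\mathcal{F}_C\text{-}\operatorname{pd}_R(M)=\operatorname{fd}_R(\operatorname{Hom}_R(C,M))$. (c) $\mathcal{F}_C\text{-}\operatorname{pd}_R(C\otimes_R M)=\operatorname{fd}_R(M)$.
   Context: $R$ is a commutative noetherian ring. A finitely generated $R$-module $C$ is semidualizing if the homothety map $R\to\operatorname{Hom}_R(C,C)$ is an isomorphism and $\operatorname{Ext}^i_R(C,C)=0$ for all $i\geq 1$. $\mathcal{F}_C(R)$ is the class of $R$-modules isomorphic to $F\otimes_R C$ with $F$ flat; it is precovering. For a precovering class $\mathcal{X}$ of $R$-modules, a proper $\mathcal{X}$-resolution of $M$ is a complex $X=(\cdots\to X_1\to X_0\to 0)$ with each $X_i\in\mathcal{X}$ together with an augmentation $X_0\to M$ such that $X^+=(\cdots\to X_1\to X_0\to M\to 0)$ is a complex (not necessarily exact) and $\operatorname{Hom}_R(Y,X^+)$ is exact for all $Y\in\mathcal{X}$. Set $$\mathcal{X}\text{-}\operatorname{pd}_R(M)=\inf\{\sup\{n\mid X_n\neq 0\}\mid X\text{ is a proper }\mathcal{X}\text{-resolution of }M\},$$ with $\mathcal{X}\text{-}\operatorname{pd}_R(0)=-\infty$. The flat dimension $\operatorname{fd}_R$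 is $\mathcal{X}\text{-}\operatorname{pd}_R$ for $\mathcal{X}$ the class of flat modules; it agrees with the classical flat dimension (with $\operatorname{fd}_R(0)=-\infty$). *)

(* Defs.v *)
From HB Require Import structures.
From mathcomp Require Import all_boot all_order all_algebra.
From mathcomp Require Import all_classical constructive_ereal prodnormedzmodule.

Set Implicit Arguments.
Unset Strict Implicit.
Unset Printing Implicit Defensive.

Import Order.TTheory GRing.Theory Num.Theory.
Local Open Scope ring_scope.
Local Open Scope classical_set_scope.
Local Open Scope quotient_scope.

(* Hom_R(U, V) is the type {linear U -> V}; its eqType and choiceType         *)
(* structures come from prodnormedzmodule.                                    *)

Section HomModule.
Variables (R : comPzRingType) (U V : lmodType R).
Implicit Types (f g h : {linear U -> V}) (a b : R).

Lemma homP f g : f =1 g -> f = g.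
Proof.
case: f => f cf; case: g => g cg /= /funext efg.
move: cf cg; rewrite {}efg => cf cg; congr GRing.Linear.Pack.
case: cf => [[f1] [f2]]; case: cg => [[g1] [g2]].
by rewrite (Prop_irrelevance f1 g1) (Prop_irrelevance f2 g2).
Qed.

Definition hom_zero : {linear U -> V} := \0.
Definition hom_opp f : {linear U -> V} := \- f.
Definition hom_add f g : {linear U -> V} := f \+ g.
Definition hom_scale a f : {linear U -> V} := a \*: f.

Fact hom_addA : associative hom_add.
Proof. by move=> f g h; apply: homP => x /=; rewrite addrA. Qed.
Fact hom_addC : commutative hom_add.
Proof. by move=> f g; apply: homP => x /=; rewrite addrC. Qed.
Fact hom_add0 : left_id hom_zero hom_add.
Proof. by move=> f; apply: homP => x /=; rewrite add0r. Qed.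
Fact hom_addN : left_inverse hom_zero hom_opp hom_add.
Proof. by move=> f; apply: homP => x /=; rewrite addNr. Qed.

HB.instance Definition _ := GRing.isZmodule.Build {linear U -> V}
  hom_addA hom_addC hom_add0 hom_addN.

Fact hom_scaleA a b f : hom_scale a (hom_scale b f) = hom_scale (a * b) f.
Proof. by apply: homP => x /=; rewrite scalerA. Qed.
Fact hom_scale1 : left_id 1 hom_scale.
Proof. by move=> f; apply: homP => x /=; rewrite scale1r. Qed.
Fact hom_scaleDr : right_distributive hom_scale +%R.
Proof. by move=> a f g; apply: homP => x /=; rewrite scalerDr. Qed.
Fact hom_scaleDl f : {morph hom_scale^~ f : a b / a + b}.
Proof. by move=> a b; apply: homP => x /=; rewrite scalerDl. Qed.

HB.instance Definition _ := GRing.Zmodule_isLmodule.Build R {linear U -> V}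
  hom_scaleA hom_scale1 hom_scaleDr hom_scaleDl.

End HomModule.

Section PostComposition.
Variables (R : comPzRingType) (Y U V : lmodType R) (g : {linear U -> V}).

Definition hom_post (f : {linear Y -> U}) : {linear Y -> V} := g \o f.

Fact hom_post_linear : linear hom_post.
Proof. by move=> a f h; apply: homP => x /=; rewrite linearP. Qed.

HB.instance Definition _ := GRing.isLinear.Build R {linear Y -> U}
  {linear Y -> V} *:%R hom_post hom_post_linear.

End PostComposition.
Arguments hom_post {R} Y {U V} g f.

(* U (x) V is the set of formal sums [:: (u_1, v_1); ..; (u_n, v_n)], where   *)
(* two sums are identified when all bilinear maps agree on them; this is      *)
(* the same quotient as the one by the bilinearity relations.                 *)

Section Tensor.
Variables (R : comPzRingType).

Definition is_bilinear (U V W : lmodType R) (b : U -> V -> W) :=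
  (forall v, linear (b^~ v)) /\ (forall u, linear (b u)).

Section Construction.
Variables (U V : lmodType R).
Implicit Types s t : seq (U * V).

Definition eval_sum (W : lmodType R) (b : U -> V -> W) s : W :=
  \sum_(p <- s) b p.1 p.2.

Definition tensor_rel : rel (seq (U * V)) := fun s t =>
  `[< forall (W : lmodType R) (b : U -> V -> W),
        is_bilinear b -> eval_sum b s = eval_sum b t >].

Fact tensor_rel_equiv : equiv_class_of tensor_rel.
Proof.
split=> [s|s t|t s u]; first exact/asboolP.
  by apply/asboolP/asboolP => e W b hb; rewrite e.
by move=> /asboolP e /asboolP e'; apply/asboolP => W b hb; rewrite e ?e'.
Qed.

Canonical tensor_equiv := EquivRelPack tensor_rel_equiv.

Definition tensor := {eq_quot tensor_equiv}.
HB.instance Definition _ := Choice.on tensor.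
HB.instance Definition _ := EqQuotient.on tensor.

Definition pure (u : U) (v : V) : tensor := \pi_tensor [:: (u, v)].

Lemma tensorP s t : reflect
  (forall (W : lmodType R) (b : U -> V -> W),
     is_bilinear b -> eval_sum b s = eval_sum b t)
  (\pi s == \pi t :> tensor).
Proof. rewrite eqquotE; exact: asboolP. Qed.

Lemma eval_repr (W : lmodType R) (b : U -> V -> W) s : is_bilinear b ->
  eval_sum b (repr (\pi s : tensor)) = eval_sum b s.
Proof. by move=> hb; have /eqP/tensorP-> := reprK (\pi s : tensor). Qed.

Definition tensor_zero : tensor := \pi_tensor [::].
Definition tensor_opp (x : tensor) : tensor :=
  \pi_tensor [seq (- p.1, p.2) | p <- repr x].
Definition tensor_add (x y : tensor) : tensor := \pi_tensor (repr x ++ repr y).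
Definition tensor_scale (a : R) (x : tensor) : tensor :=
  \pi_tensor [seq (a *: p.1, p.2) | p <- repr x].

Section Eval.
Variables (W : lmodType R) (b : U -> V -> W).
Hypothesis hb : is_bilinear b.

Let bZ a u v : b (a *: u) v = a *: b u v.
Proof.
have b0 : b 0 v = 0.
  by have := hb.1 v (-1) 0 0; rewrite scaler0 addr0 scaleN1r addNr.
by have := hb.1 v a u 0; rewrite !addr0 b0 addr0.
Qed.

Lemma eval_zero : eval_sum b (repr tensor_zero) = 0.
Proof. by rewrite eval_repr // /eval_sum big_nil. Qed.

Lemma eval_scale a x :
  eval_sum b (repr (tensor_scale a x)) = a *: eval_sum b (repr x).
Proof.
rewrite eval_repr // /eval_sum big_map scaler_sumr.
by apply: eq_bigr => p _ /=.
Qed.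

Lemma eval_opp x : eval_sum b (repr (tensor_opp x)) = - eval_sum b (repr x).
Proof.
rewrite eval_repr // /eval_sum big_map -sumrN.
by apply: eq_bigr => p _ /=; rewrite -scaleN1r bZ scaleN1r.
Qed.

Lemma eval_add x y : eval_sum b (repr (tensor_add x y)) =
  eval_sum b (repr x) + eval_sum b (repr y).
Proof. by rewrite eval_repr // /eval_sum big_cat. Qed.

End Eval.

Lemma tensor_ext (x y : tensor) :
  (forall (W : lmodType R) (b : U -> V -> W), is_bilinear b ->
     eval_sum b (repr x) = eval_sum b (repr y)) -> x = y.
Proof. by move=> e; rewrite -[x]reprK -[y]reprK; apply/eqP/tensorP. Qed.

Fact tensor_addA : associative tensor_add.
Proof. by move=> *; apply: tensor_ext => W b hb; rewrite !eval_add // addrA. Qed.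
Fact tensor_addC : commutative tensor_add.
Proof. by move=> *; apply: tensor_ext => W b hb; rewrite !eval_add // addrC. Qed.
Fact tensor_add0 : left_id tensor_zero tensor_add.
Proof.
by move=> *; apply: tensor_ext => W b hb; rewrite eval_add // eval_zero // add0r.
Qed.
Fact tensor_addN : left_inverse tensor_zero tensor_opp tensor_add.
Proof.
move=> *; apply: tensor_ext => W b hb.
by rewrite eval_add // eval_zero // eval_opp // addNr.
Qed.

HB.instance Definition _ := GRing.isZmodule.Build tensor
  tensor_addA tensor_addC tensor_add0 tensor_addN.

Fact tensor_scaleA a a' x :
  tensor_scale a (tensor_scale a' x) = tensor_scale (a * a') x.
Proof. by apply: tensor_ext => W b hb; rewrite !eval_scale // scalerA. Qed.
Fact tensor_scale1 : left_id 1 tensor_scale.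
Proof. by move=> *; apply: tensor_ext => W b hb; rewrite eval_scale // scale1r. Qed.
Fact tensor_scaleDr : right_distributive tensor_scale +%R.
Proof.
move=> *; apply: tensor_ext => W b hb.
by rewrite eval_scale // !eval_add // scalerDr !eval_scale.
Qed.
Fact tensor_scaleDl x : {morph tensor_scale^~ x : a b / a + b}.
Proof.
move=> *; apply: tensor_ext => W b hb.
by rewrite eval_add // !eval_scale // scalerDl.
Qed.

HB.instance Definition _ := GRing.Zmodule_isLmodule.Build R tensor
  tensor_scaleA tensor_scale1 tensor_scaleDr tensor_scaleDl.

Lemma pure_bilinear : is_bilinear pure.
Proof.
by split=> [v a u u'|u a v v']; apply: tensor_ext => W b hb;
   rewrite eval_add // eval_scale // !eval_repr // /eval_sum !big_seq1 /=;
   rewrite ?hb.1 ?hb.2.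
Qed.

Lemma pure_span (x : tensor) : x = \sum_(p <- repr x) pure p.1 p.2.
Proof.
rewrite -{1}[x]reprK; elim: (repr x) => [|p s IHs]; first by rewrite big_nil.
rewrite big_cons -IHs; apply: tensor_ext => W b hb.
by rewrite eval_add // !eval_repr // /eval_sum big_cons big_seq1.
Qed.

Section Lift.
Variables (W : lmodType R) (b : U -> V -> W) (hb : is_bilinear b).

Definition tensor_lift of is_bilinear b := fun x : tensor => eval_sum b (repr x).

Fact tensor_lift_linear : linear (tensor_lift hb).
Proof. by move=> a x y; rewrite /tensor_lift eval_add // eval_scale. Qed.

HB.instance Definition _ := GRing.isLinear.Build R tensor W *:%R
  (tensor_lift hb) tensor_lift_linear.

Lemma tensor_lift_pure u v : tensor_lift hb (pure u v) = b u v.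
Proof. by rewrite /tensor_lift eval_repr // /eval_sum big_seq1. Qed.

Lemma tensor_lift_unique (g : {linear tensor -> W}) :
  (forall u v, g (pure u v) = b u v) -> g =1 tensor_lift hb.
Proof.
move=> gb x; rewrite {1}[x]pure_span linear_sum.
by apply: eq_bigr => p _; rewrite gb.
Qed.

End Lift.
End Construction.

Section Functoriality.
Variables (U U' V V' : lmodType R).
Variables (f : {linear U -> U'}) (g : {linear V -> V'}).

Fact tensor_map_bilinear : is_bilinear (fun u v => pure (f u) (g v)).
Proof.
have [hl hr] := pure_bilinear U' V'.
by split=> [v a u u'|u a v v']; rewrite linearP ?hl ?hr.
Qed.

Definition tensor_map : {linear tensor U V -> tensor U' V'} :=
  tensor_lift tensor_map_bilinear.

End Functoriality.
End Tensor.

Arguments tensor {R} U V.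

Notation "U ⊗ V" := (tensor U V) (at level 40, left associativity) : type_scope.

Section Modules.
Variable R : comPzRingType.
Implicit Types M N F P C X : lmodType R.

Definition zero_module M := forall x : M, x = 0.

Definition isomorphic M N := exists f : {linear M -> N}, bijective f.

Definition finitely_generated M :=
  exists (n : nat) (e : 'I_n -> M),
    forall x, exists a : 'I_n -> R, x = \sum_i a i *: e i.

Definition flat F := forall (A B : lmodType R) (f : {linear A -> B}),
  injective f -> injective (tensor_map idfun f : F ⊗ A -> F ⊗ B).

Definition projective P :=
  forall (A B : lmodType R) (p : {linear A -> B}) (f : {linear P -> B}),
    (forall b, exists a, p a = b) ->
    exists g : {linear P -> A}, forall x, p (g x) = f x.

Definition FC C X := exists2 F, flat F & isomorphic X (F ⊗ C).

End Modules.

Definition is_ideal (R : comPzRingType) (I : set R) :=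
  [/\ I 0, forall x y, I x -> I y -> I (x + y) & forall a x, I x -> I (a * x)].

Definition noetherian (R : comPzRingType) := forall I : set R, is_ideal I ->
  exists (n : nat) (e : 'I_n -> R), (forall i, I (e i)) /\
    forall x, I x -> exists a : 'I_n -> R, x = \sum_i a i * e i.

Section Complexes.
Variable R : comPzRingType.
Implicit Types M N C Y : lmodType R.

(* ... -> X_1 -> X_0 -> 0, where [boundary n] is the map X_(n+1) -> X_n.      *)
Record chain_complex := ChainComplex {
  obj :> nat -> lmodType R;
  boundary : forall n, {linear obj n.+1 -> obj n};
  boundaryK : forall n x, boundary n (boundary n.+1 x) = 0
}.
Arguments boundary : clear implicits.

Definition is_exact (X : chain_complex) :=
  (forall y : X 0%N, exists x, boundary X 0 x = y) /\
  (forall n (y : X n.+1), boundary X n y = 0 ->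
     exists x, boundary X n.+1 x = y).

Section HomComplex.
Variables (Y : lmodType R) (X : chain_complex).

Definition hom_obj n : lmodType R := {linear Y -> X n}.
Definition hom_boundary n : {linear hom_obj n.+1 -> hom_obj n} :=
  hom_post Y (boundary X n).
Fact hom_boundaryK n f : hom_boundary n (hom_boundary n.+1 f) = 0.
Proof. by apply: homP => y; exact: boundaryK. Qed.
Definition hom_complex := ChainComplex hom_boundaryK.

End HomComplex.

(* Complexes with an augmentation X_0 -> M.                                   *)
Record augmented M := Augmented {
  cplx :> chain_complex;
  aug : {linear cplx 0%N -> M};
  aug_boundary : forall x, aug (boundary cplx 0 x) = 0
}.

(* X^+ = (... -> X_1 -> X_0 -> M -> 0), with M placed in degree 0.            *)
Section AugmentedComplex.
Variables (M : lmodType R) (X : augmented M).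

Definition aug_complex_obj n : lmodType R := if n is m.+1 then X m else M.
Definition aug_complex_boundary n :
    {linear aug_complex_obj n.+1 -> aug_complex_obj n} :=
  match n with 0%N => aug X | m.+1 => boundary X m end.
Fact aug_complex_boundaryK n x :
  aug_complex_boundary n (aug_complex_boundary n.+1 x) = 0.
Proof. by case: n x => [|n] x; [exact: aug_boundary | exact: boundaryK]. Qed.
Definition aug_complex := ChainComplex aug_complex_boundaryK.

End AugmentedComplex.

Definition proper_resolution (K : lmodType R -> Prop) M (X : augmented M) :=
  (forall n, K (X n)) /\
  (forall Y, K Y -> is_exact (hom_complex Y (aug_complex X))).

(* sup {n | X_n <> 0}, which is -oo for the zero complex.                     *)
Definition complex_length (X : chain_complex) : \bar int :=
  supremum -oo%E [set (n%:Z)%:E%E | n in [set n | ~ zero_module (X n)]].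

Definition proper_dim (K : lmodType R -> Prop) M : \bar int :=
  infimum +oo%E
    [set d | exists2 X : augmented M,
       proper_resolution K X & d = complex_length X].

Definition flat_dim M := proper_dim (@flat R) M.

(* An exact sequence 0 -> L_n -> ... -> L_0 -> M -> 0 with all L_i in K.      *)
Definition exact_resolution (K : lmodType R -> Prop) (n : nat) M
    (L : augmented M) :=
  [/\ forall i, (i <= n)%N -> K (L i),
      forall i, (n < i)%N -> zero_module (L i) & is_exact (aug_complex L)].

Definition projective_resolution M (P : augmented M) :=
  (forall n, projective (P n)) /\ is_exact (aug_complex P).

(* Ext^(i+1)_R(M, N) = H^(i+1)(Hom_R(P, N)) is zero, where P is a projective  *)
(* resolution of M: each (i+1)-cocycle P_(i+1) -> N is a coboundary. The      *)
(* choice of P is irrelevant.                                                 *)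
Definition ExtS_eq0 (i : nat) M N :=
  forall P : augmented M, projective_resolution P ->
  forall f : {linear P i.+1 -> N},
    (forall x, f (boundary P i.+1 x) = 0) ->
    exists g : {linear P i -> N}, forall x, f x = g (boundary P i x).

Definition homothety C (a : R) : {linear C -> C} := a \*: idfun.

Definition semidualizing C :=
  [/\ finitely_generated C, bijective (@homothety C) &
      forall i, ExtS_eq0 i C C].

End Complexes.
Arguments boundary {R} X n : rename.

(* Main.v *)
Require Import Defs.
From HB Require Import structures.
From mathcomp Require Import all_boot all_order all_algebra.
From mathcomp Require Import all_classical constructive_ereal prodnormedzmodule.

(** The proof compares modules M with Hom(C, M) and rests on four observations.

    Applying Hom(-, C) to a resolution of C by finitely generated free modules
    gives an exact sequence 0 -> R -> C^n0 -> C^n1 -> ..., because C is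
    semidualizing. A flat module F keeps it exact, so F = Hom(C, F ⊗ C)
    ([flat_hom], [flat_hom_inj]) and Ext^i(C, F ⊗ C) = 0 for i > 0
    ([flat_Ext_vanish]). Hence Hom(C, -) and - ⊗ C are inverse equivalences
    between the class F_C and the flat modules, and by adjunction they exchange
    the proper F_C-resolutions of M with the proper flat resolutions of
    Hom(C, M), without changing lengths: this is (b), [FC_dim_hom].

    The module C detects zero: Hom(C, M) = 0 forces M = 0 ([hom_eq0]). In a
    bounded complex ... -> X_1 -> X_0 -> M -> 0 with all X_i in F_C, the vanishing
    of Ext passes from the left end to all boundary modules. Therefore such a
    complex is exact as soon as Hom(C, -) of it is exact ([exact_of_hom_exact]), and conversely
    ([exact_hom_lift]). So a bounded proper F_C-resolution is exact, which is one
    half of (a), and Hom(C, -) turns a bounded exact F_C-resolution of M into a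
    bounded exact flat resolution of Hom(C, M).

    An exact flat resolution need not be proper, since maps from a flat module do
    not have to lift along it. For the other half of (a) it has to be replaced by
    a proper one of the same length. Write G^+ for the character module
    Hom_Z(G, Q/Z). Over a noetherian ring, if F is flat then F^++ is flat, and it
    is cotorsion: maps into it extend along every injection with flat cokernel.
    The embedding of F in F^++ has a flat cokernel. Embedding one syzygy after the
    other in such modules and pushing out produces a flat resolution with
    cotorsion kernels, along which maps from flat modules lift
    ([flat_cotorsion_embedding], [proper_length_of_flat]).

    For (c), by (b) it is enough that M -> Hom(C, M ⊗ C) is bijective, and this
    holds as soon as one of the two dimensions is finite
    ([eta_bijective_of_flat_dim], [eta_bijective_of_FC_dim]); otherwise both are
    infinite.

    Exactness of tensor products is handled through characters: a character of
    F ⊗ V is a linear map V -> F^+, so exactness of F ⊗ - on a sequence is a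
    factorization property of maps into F^+ ([tensor_exact]), and F is flat
    exactly when F^+ is injective ([flat_baer], [baer_flat]). *)

Set Implicit Arguments.
Unset Strict Implicit.
Unset Printing Implicit Defensive.

Import Order.TTheory GRing.Theory Num.Theory.
Local Open Scope ring_scope.
Local Open Scope classical_set_scope.
Local Open Scope quotient_scope.

(** * Submodules and quotients *)

Section Submodules.
Variables (S : comPzRingType) (M : lmodType S).

Definition submodule_set (A : set M) :=
  A 0 /\ forall a x y, A x -> A y -> A (a *: x + y).

Record submodule := Submodule { subset_of :> M -> Prop; submoduleP : submodule_set subset_of }.

Implicit Type A : submodule.

Lemma submod0 A : A 0. Proof. exact: (submoduleP A).1. Qed.
Lemma submodP A a x y : A x -> A y -> A (a *: x + y).
Proof. exact: (submoduleP A).2. Qed.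
Lemma submodD A x y : A x -> A y -> A (x + y).
Proof. by move=> Ax Ay; rewrite -[x]scale1r; apply: submodP. Qed.
Lemma submodZ A a x : A x -> A (a *: x).
Proof. by move=> Ax; rewrite -[_ *: x]addr0; apply: submodP => //; apply: submod0. Qed.
Lemma submodN A x : A x -> A (- x).
Proof. by rewrite -scaleN1r; apply: submodZ. Qed.
Lemma submodB A x y : A x -> A y -> A (x - y).
Proof. by move=> Ax Ay; apply: submodD => //; apply: submodN. Qed.
Lemma submod_sum A I (r : seq I) (P : pred I) (F : I -> M) :
  (forall i, P i -> A (F i)) -> A (\sum_(i <- r | P i) F i).
Proof. by move=> AF; apply: big_ind => //; [apply: submod0 | apply: submodD]. Qed.

Variable A : submodule.

Definition sub_pred : {pred M} := [pred x | `[< A x >]].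

Fact sub_pred_closed : subsemimod_closed sub_pred.
Proof.
split; first split.
- by apply/asboolP/submod0.
- by move=> x y /asboolP Ax /asboolP Ay; apply/asboolP/submodD.
- by move=> a x /asboolP Ax; apply/asboolP/submodZ.
Qed.
HB.instance Definition _ := GRing.isSubmodClosed.Build S M sub_pred sub_pred_closed.

Record sub := Sub { sub_val :> M; sub_valP : sub_val \in sub_pred }.
HB.instance Definition _ := [isSub for sub_val].
HB.instance Definition _ := [Choice of sub by <:].
HB.instance Definition _ := [SubChoice_isSubLmodule of sub by <:].

Lemma subP (x : sub) : A (val x).
Proof. by case: x => x /= /asboolP. Qed.

Definition to_sub x (Ax : A x) : sub := Sub (asboolT Ax).

Definition incl : {linear sub -> M} := val.

Lemma incl_inj : injective incl. Proof. exact: val_inj. Qed.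

Definition quo_rel : rel M := fun x y => `[< A (x - y) >].

Fact quo_rel_equiv : equiv_class_of quo_rel.
Proof.
split=> [x|x y|x y z]; first by apply/asboolP; rewrite subrr; apply: submod0.
  by apply/asboolP/asboolP => /submodN; rewrite opprB.
move=> /asboolP Axy /asboolP Ayz; apply/asboolP.
by have := submodD Axy Ayz; rewrite addrA subrK.
Qed.

Canonical quo_equiv := EquivRelPack quo_rel_equiv.

Definition quo := {eq_quot quo_equiv}.
HB.instance Definition _ := Choice.on quo.
HB.instance Definition _ := EqQuotient.on quo.

Definition pr (x : M) : quo := \pi_quo x.

Lemma pr_eq x y : pr x = pr y <-> A (x - y).
Proof.
split=> [/eqP|Axy].
  by rewrite eqquotE => /asboolP.
by apply/eqP; rewrite eqquotE; apply/asboolP.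
Qed.

Lemma pr_surj (u : quo) : exists x, pr x = u.
Proof. by exists (repr u); apply: reprK. Qed.

Definition quo_zero : quo := pr 0.
Definition quo_opp (u : quo) : quo := pr (- repr u).
Definition quo_add (u v : quo) : quo := pr (repr u + repr v).
Definition quo_scale (a : S) (u : quo) : quo := pr (a *: repr u).

Lemma repr_pr x : A (repr (pr x) - x).
Proof. by apply/pr_eq; apply: reprK. Qed.

Lemma quo_oppE x : quo_opp (pr x) = pr (- x).
Proof. by apply/pr_eq; rewrite -opprD; apply/submodN/repr_pr. Qed.
Lemma quo_addE x y : quo_add (pr x) (pr y) = pr (x + y).
Proof. by apply/pr_eq; rewrite opprD addrACA; apply/submodD; apply: repr_pr. Qed.
Lemma quo_scaleE a x : quo_scale a (pr x) = pr (a *: x).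
Proof. by apply/pr_eq; rewrite -scalerBr; apply/submodZ/repr_pr. Qed.

Fact quo_addA : associative quo_add.
Proof.
move=> u v w; have [[x <-] [y <-] [z <-]] := And3 (pr_surj u) (pr_surj v) (pr_surj w).
by rewrite !quo_addE addrA.
Qed.
Fact quo_addC : commutative quo_add.
Proof.
by move=> u v; have [x <-] := pr_surj u; have [y <-] := pr_surj v; rewrite !quo_addE addrC.
Qed.
Fact quo_add0 : left_id quo_zero quo_add.
Proof. by move=> u; have [x <-] := pr_surj u; rewrite quo_addE add0r. Qed.
Fact quo_addN : left_inverse quo_zero quo_opp quo_add.
Proof.
by move=> u; have [x <-] := pr_surj u; rewrite quo_oppE quo_addE addNr.
Qed.
HB.instance Definition _ := GRing.isZmodule.Build quo quo_addA quo_addC quo_add0 quo_addN.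

Fact quo_scaleA a b u : quo_scale a (quo_scale b u) = quo_scale (a * b) u.
Proof. by have [x <-] := pr_surj u; rewrite !quo_scaleE scalerA. Qed.
Fact quo_scale1 : left_id 1 quo_scale.
Proof. by move=> u; have [x <-] := pr_surj u; rewrite !quo_scaleE scale1r. Qed.
Fact quo_scaleDr : right_distributive quo_scale +%R.
Proof.
move=> a u v; have [x <-] := pr_surj u; have [y <-] := pr_surj v.
by rewrite ![_ + _]quo_addE !quo_scaleE scalerDr [in RHS]/GRing.add /= quo_addE.
Qed.
Fact quo_scaleDl u : {morph quo_scale^~ u : a b / a + b}.
Proof.
move=> a b; have [x <-] := pr_surj u.
by rewrite !quo_scaleE scalerDl [in RHS]/GRing.add /= quo_addE.
Qed.
HB.instance Definition _ := GRing.Zmodule_isLmodule.Build S quo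
  quo_scaleA quo_scale1 quo_scaleDr quo_scaleDl.

Fact pr_linear : linear pr.
Proof.
move=> a x y.
by rewrite [in RHS]/GRing.add [in RHS]/GRing.scale /= quo_scaleE quo_addE.
Qed.
HB.instance Definition _ := GRing.isLinear.Build S M quo *:%R pr pr_linear.

Lemma prZ a x : pr (a *: x) = a *: pr x. Proof. exact: linearZZ. Qed.

Lemma pr_eq0 x : pr x = 0 <-> A x.
Proof. by rewrite -[0](linear0 pr) pr_eq subr0. Qed.

End Submodules.
Arguments incl {S M} A.
Arguments pr {S M} A.

(** * Linear relations, Baer's criterion and divisibility of Q/Z *)

Section LinearRelations.
Variable S : comPzRingType.

Section MkLinear.
Variables (U V : lmodType S) (f : U -> V).
Definition lin of linear f := f.
Hypothesis fl : linear f.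
HB.instance Definition _ := GRing.isLinear.Build S U V *:%R (lin fl) fl.
Definition mklin : {linear U -> V} := lin fl.
Lemma mklinE x : mklin x = f x. Proof. by []. Qed.
End MkLinear.

Lemma scale_comb (U : lmodType S) a b b' (x y y' : U) :
  a *: (b *: x + y) + (b' *: x + y') = (a * b + b') *: x + (a *: y + y').
Proof. by rewrite scalerDr scalerDl scalerA addrACA. Qed.

(** Linear maps are constructed from their graphs below: a relation avoids
    choosing preimages and then showing that the choice does not matter. *)
Definition linrel (U V : lmodType S) (P : U -> V -> Prop) :=
  P 0 0 /\ forall a x x' y y', P x y -> P x' y' -> P (a *: x + x') (a *: y + y').

Definition functional (U V : lmodType S) (P : U -> V -> Prop) :=
  forall y, P 0 y -> y = 0.

Lemma linrel_sub (U V : lmodType S) (P : U -> V -> Prop) x x' y y' :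
  linrel P -> P x y -> P x' y' -> P (x - x') (y - y').
Proof.
move=> [_ PP] Pxy Pxy'; have := PP (-1) _ _ _ _ Pxy' Pxy.
by rewrite !scaleN1r addrC [- y' + _]addrC.
Qed.

Lemma linrel_scale (U V : lmodType S) (P : U -> V -> Prop) a x y :
  linrel P -> P x y -> P (a *: x) (a *: y).
Proof. by move=> [P0 PP] Pxy; have := PP a _ _ _ _ Pxy P0; rewrite !addr0. Qed.

Lemma functional_eq (U V : lmodType S) (P : U -> V -> Prop) x y y' :
  linrel P -> functional P -> P x y -> P x y' -> y = y'.
Proof.
move=> Pl Pf Pxy Pxy'; apply/eqP; rewrite -subr_eq0; apply/eqP/Pf.
by rewrite -(subrr x); apply: linrel_sub.
Qed.

Lemma linear_of_rel (U V : lmodType S) (P : U -> V -> Prop) :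
  linrel P -> functional P -> (forall x, exists y, P x y) ->
  exists f : {linear U -> V}, (forall x, P x (f x)) /\ forall x y, P x y -> y = f x.
Proof.
move=> Pl Pf /choice[f Pfx].
have fP x y : P x y -> y = f x by move=> Pxy; apply: (functional_eq Pl Pf Pxy).
have fl : linear f by move=> a x y; apply/esym/fP; apply: Pl.2; apply: Pfx.
by exists (mklin fl).
Qed.

(** Baer's criterion for injectivity: a linear map from an ideal to J, given by
    its graph P, is multiplication of scalars by some element of J. *)
Definition baer (J : lmodType S) := forall P : S^o -> J -> Prop,
  linrel P -> functional P -> exists x, forall a y, P a y -> y = (a : S) *: x.

(** Injectivity from Baer's criterion. By Zorn's lemma there is a maximal
    functional graph G containing P. For x in B, the pairs (a, y) with
    G (a x) y form the graph of a map from an ideal, so some y satisfies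
    G (a x) z -> z = a y, and adding the multiples of (x, y) keeps the graph
    functional; by maximality x was already in its domain. *)
Lemma baer_extend (J B : lmodType S) (P : B -> J -> Prop) :
  baer J -> linrel P -> functional P ->
  exists f : {linear B -> J}, forall x y, P x y -> y = f x.
Proof.
move=> Jb Pl Pf.
pose rel_of (X : set (B * J)) x y := X (x, y) \/ P x y.
pose Q (X : set (B * J)) := linrel (rel_of X) /\ functional (rel_of X).
(* [Q] adds P to each set so that the empty chain has an admissible union. *)
have [F FQ Ftot|A [[Al Af] Amax]] := @Zorn_bigcup _ Q.
  have cup x y : rel_of (\bigcup_(X in F) X) x y ->
      P x y \/ exists2 X, F X & rel_of X x y.
    by case=> [[X FX Xxy]|]; [right; exists X => //; left | left].
  have rel_cup X x y : F X -> rel_of X x y -> rel_of (\bigcup_(X in F) X) x y.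
    by move=> FX [Xxy|]; [left; exists X | right].
  split; first split.
  - by right; apply: Pl.1.
  - move=> a x x' y y' /cup[Pxy|[X FX Xxy]] /cup[Pxy'|[X' FX' Xxy']].
    + by right; apply: Pl.2.
    + by apply: (rel_cup _ _ _ FX'); apply: (FQ _ FX').1.2 => //; right.
    + by apply: (rel_cup _ _ _ FX); apply: (FQ _ FX).1.2 => //; right.
    + have [XX'|X'X] := Ftot _ _ FX FX'.
        apply: (rel_cup _ _ _ FX'); apply: (FQ _ FX').1.2 => //.
        by case: Xxy => [/XX'|]; [left | right].
      apply: (rel_cup _ _ _ FX); apply: (FQ _ FX).1.2 => //.
      by case: Xxy' => [/X'X|]; [left | right].
  - move=> y /cup[/Pf //|[X FX Xy]]; exact: (FQ _ FX).2.
pose G := rel_of A.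
suff Gtot x : exists y, G x y.
  have [f [_ fP]] := linear_of_rel Al Af Gtot.
  by exists f => x y Pxy; apply: fP; right.
have [|y Py0|y yP] := Jb (fun a y => G (a *: x) y).
- split=> [|a b b' y y' Gb Gb']; first by rewrite scale0r; apply: Al.1.
  by rewrite scalerDl -scalerA; apply: Al.2.
- by apply: Af; rewrite -[0](scale0r x).
exists y; pose G' (p : B * J) := exists a u v, G u v /\ p = (a *: x + u, a *: y + v).
have GG' u v : G u v -> G' (u, v).
  by move=> Guv; exists 0, u, v; rewrite !scale0r !add0r.
have AG' : A `<=` G' by case=> u v Auv; apply: GG'; left.
have G'E u v : rel_of G' u v -> G' (u, v).
  by case=> // Puv; apply: GG'; right.
have G'xy : G' (x, y).
  by exists 1, 0, 0; split; [exact: Al.1 | rewrite !scale1r !addr0].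
apply: contrapT => nGxy; apply: (Amax G').
  by split=> // G'A; apply: nGxy; left; apply: G'A.
split; first split.
- by right; apply: Pl.1.
- move=> a u u' v v' /G'E[b [w [z [Gwz [-> ->]]]]] /G'E[b' [w' [z' [Gwz' [-> ->]]]]].
  left; exists (a * b + b'), (a *: w + w'), (a *: z + z'); split; first exact: Al.2.
  by rewrite !scale_comb.
- move=> v /G'E[a [w [z [Gwz [/esym/eqP]]]]].
  rewrite addr_eq0 => /eqP axw ->.
  have /yP -> : G ((- a) *: x) z by rewrite scaleNr axw opprK.
  by rewrite scaleNr subrr.
Qed.

End LinearRelations.

Section IntegerModules.

Lemma int_ideal (I : int -> Prop) :
  I 0 -> (forall a x y, I x -> I y -> I (a * x + y)) ->
  exists m : nat, I m%:Z /\ forall k, I k -> (m%:Z %| k)%Z.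
Proof.
move=> I0 IP.
have IN x : I x -> I (- x) by move=> Ix; have := IP (-1) _ _ Ix I0; rewrite mulN1r addr0.
have [[k [Ik k0]]|nI] := pselect (exists k, I k /\ k != 0); last first.
  exists 0%N; split=> // k Ik; have [->|k0] := eqVneq k 0; first exact: dvdz0.
  by case: nI; exists k.
have [m /andP[/asboolP Im m0] mmin] : {m | `[< I m%:Z >] && (0 < m)%N
    & forall k, `[< I k%:Z >] && (0 < k)%N -> (m <= k)%N}.
  have ex : exists m, `[< I m%:Z >] && (0 < m)%N.
    exists `|k|%N; rewrite absz_gt0 k0 andbT; apply/asboolP.
    by case: k Ik {k0} => n //= /IN; rewrite NegzE opprK.
  by exists (ex_minn ex); case: ex_minnP.
exists m; split=> // l Il; apply/dvdz_mod0P; have [//|r0] := eqVneq (l %% m)%Z 0.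
have m0' : m%:Z != 0 by rewrite eqz_nat -lt0n.
have rE : (l %% m)%Z = (- (l %/ m)%Z) * m%:Z + l by rewrite mulNr addrC.
have Ir : I (l %% m)%Z by rewrite rE; apply: IP.
have r_ge0 := modz_ge0 l m0'; have r_lt := ltz_pmod l (_ : 0 < m%:Z).
have := mmin `|(l %% m)%Z|%N; rewrite absz_gt0 r0 andbT => le.
have : (m <= `|(l %% m)%Z|)%N by apply: le; apply/asboolP; rewrite gez0_abs.
by rewrite -lez_nat gez0_abs // leNgt r_lt.
Qed.

Fact int_in_rat : submodule_set (fun q : zmodule rat => exists n : int, q = n%:~R :> rat).
Proof.
split; first by exists 0.
move=> a _ _ [n ->] [m ->]; exists (n * a + m).
by rewrite scalezrE rmorphD rmorphM /= mulrzr.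
Qed.

Definition QZ := quo (Submodule int_in_rat).
HB.instance Definition _ := GRing.Lmodule.on QZ.

Definition qz (q : rat) : QZ := pr (Submodule int_in_rat) q.

Lemma qz_scale n (q : rat) : n *: qz q = qz (q *~ n).
Proof. by rewrite /qz -prZ. Qed.

Lemma qz0 q : qz q = 0 <-> exists n : int, q = n%:~R.
Proof. exact: (pr_eq0 (Submodule int_in_rat)). Qed.

Lemma qz_div (u : QZ) (m : nat) : (0 < m)%N -> exists v : QZ, u = m%:Z *: v.
Proof.
move=> m0; have [q <-] := pr_surj u; exists (qz (q / m%:R)).
have -> // : m%:Z *: qz (q / m%:R) = qz q.
by rewrite qz_scale -mulrzr -pmulrn divfK // pnatr_eq0 -lt0n.
Qed.

Lemma qz_baer : baer QZ.
Proof.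
move=> P Pl Pf; have [||m [[y0 Py0] Im]] := @int_ideal (fun k => exists y, P k y).
- by exists 0; apply: Pl.1.
- move=> a x x' [y Pxy] [y' Pxy']; exists (a *: y + y').
  exact: (Pl.2 a x x' y y').
have [m0|m0] := posnP m.
  exists 0 => a y Pay; rewrite scaler0; apply: Pf.
  by have := Im a (ex_intro _ y Pay); rewrite m0 dvd0z => /eqP <-.
have [v vE] := qz_div y0 m0; exists v => a y Pay.
have /dvdzP[q aE] := Im a (ex_intro _ y Pay).
have Pq := linrel_scale q Pl Py0.
have -> : y = q *: y0.
  apply: (functional_eq Pl Pf Pay); rewrite aE; exact: Pq.
by rewrite vE scalerA -aE.
Qed.

(** If m x is the first positive multiple of x in A, sending x to 1/m and A to 0
    is consistent; if there is none, sending x to 1/2 is. *)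
Lemma qz_separates (G : lmodType int) (A : submodule G) x : ~ A x ->
  exists f : {linear G -> QZ}, (forall y, A y -> f y = 0) /\ f x <> 0.
Proof.
move=> nAx.
have [m [m1 mP]] : exists m : nat, (1 < m)%N /\ forall k : int, A (k *: x) -> (m%:Z %| k)%Z.
  have [||m [Im mP]] := @int_ideal (fun k => A (k *: x)).
  - by rewrite scale0r; apply: submod0.
  - by move=> a k l Ak Al; rewrite scalerDl -scalerA; apply: submodP.
  case: m Im mP => [|[|m]] Im mP; last by exists m.+2.
    by exists 2%N; split=> // k /mP; rewrite dvd0z => /eqP->; apply: dvdz0.
  by case: nAx; rewrite -[x]scale1r.
pose P (y : G) (z : QZ) := exists a s, A s /\ y = a *: x + s /\ z = a *: qz (m%:R^-1).
have [||f fP] := @baer_extend _ QZ G P qz_baer.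
- split; first by exists 0, 0; rewrite !scale0r addr0; split=> //; apply: submod0.
  move=> a _ _ _ _ [b [s [As [-> ->]]]] [b' [s' [As' [-> ->]]]].
  exists (a * b + b'), (a *: s + s'); split; first exact: submodP.
  by split; [exact: scale_comb | rewrite scalerDl scalerA].
- move=> z [a [s [As [/esym/eqP]]]]; rewrite addr_eq0 => /eqP axs ->.
  have /mP/dvdzP[q ->] : A (a *: x) by rewrite axs; apply: submodN.
  rewrite qz_scale; apply/qz0; exists q.
  rewrite -mulrzr rmorphM /= mulrCA -pmulrn mulVf ?mulr1 // pnatr_eq0.
  by case: m m1 {mP P}.
exists f; split=> [y Ay|].
  by apply/esym/fP; exists 0, y; split=> //; rewrite !scale0r add0r.
have <- : 1 *: qz (m%:R^-1) = f x.
  apply: fP; exists 1, 0; split; [exact: submod0|split=> //].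
  by rewrite scale1r addr0.
rewrite scale1r => /qz0[n].
have m0 : m%:R != 0 :> rat by rewrite pnatr_eq0; case: m m1 {mP P f fP}.
move/(congr1 ( *%R^~ m%:R)); rewrite mulVf // => /eqP.
rewrite pmulrn -intrM -[1]/(1%:~R) eqr_int => /eqP e.
have := dvdz_mull n (dvdzz m%:Z); rewrite -e dvdz1 /=.
by case: m m1 {mP P f fP m0 e} => [|[]].
Qed.

End IntegerModules.

(** * Tensor products and character modules *)

Section TensorBasics.
Variable R : comPzRingType.
Implicit Types U V W : lmodType R.

Lemma pureP U V a (u u' : U) (v : V) : pure (a *: u + u') v = a *: pure u v + pure u' v.
Proof. exact: (pure_bilinear U V).1. Qed.
Lemma pure0l U V (v : V) : pure (0 : U) v = 0.
Proof. by have := pureP (-1) 0 (0 : U) v; rewrite scaler0 addr0 scaleN1r addNr. Qed.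
Lemma pureZl U V a (u : U) (v : V) : pure (a *: u) v = a *: pure u v.
Proof. by rewrite -[a *: u]addr0 pureP pure0l addr0. Qed.
Lemma pureDl U V (u u' : U) (v : V) : pure (u + u') v = pure u v + pure u' v.
Proof. by rewrite -{1}[u]scale1r pureP scale1r. Qed.
Lemma pure_linear_r U V (u : U) : linear (pure u : V -> _).
Proof. exact: (pure_bilinear U V).2. Qed.
Lemma pure0r U V (u : U) : pure u (0 : V) = 0.
Proof. exact: (linear0 (mklin (@pure_linear_r U V u))). Qed.
Lemma pureZr U V a (u : U) (v : V) : pure u (a *: v) = a *: pure u v.
Proof. exact: (linearZZ (mklin (@pure_linear_r U V u))). Qed.
Lemma pureDr U V (u : U) (v v' : V) : pure u (v + v') = pure u v + pure u v'.
Proof. exact: (linearD (mklin (@pure_linear_r U V u))). Qed.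
Lemma pure_linear_l U V (v : V) : linear (fun u : U => pure u v).
Proof. by move=> a x y; exact: pureP. Qed.
Lemma pure_suml U V I (r : seq I) (F : I -> U) (v : V) :
  pure (\sum_(i <- r) F i) v = \sum_(i <- r) pure (F i) v.
Proof. exact: (linear_sum (mklin (@pure_linear_l U V v))). Qed.
Lemma pure_sumr U V I (r : seq I) (F : I -> V) (u : U) :
  pure u (\sum_(i <- r) F i) = \sum_(i <- r) pure u (F i).
Proof. exact: (linear_sum (mklin (@pure_linear_r U V u))). Qed.

Lemma tensor_mapE U V U' V' (f : {linear U -> U'}) (g : {linear V -> V'}) u v :
  tensor_map f g (pure u v) = pure (f u) (g v).
Proof. exact: tensor_lift_pure. Qed.

Lemma tensor_eq U V W (f g : {linear U ⊗ V -> W}) :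
  (forall u v, f (pure u v) = g (pure u v)) -> f =1 g.
Proof.
move=> fg x; rewrite [x]pure_span !linear_sum.
by apply: eq_bigr => p _; apply: fg.
Qed.

Lemma tensor_zero_module U V : (forall (u : U) (v : V), pure u v = 0) ->
  zero_module (U ⊗ V).
Proof. by move=> p0 x; rewrite [x]pure_span big1. Qed.

Fact swap_bilinear U V : is_bilinear (fun (u : U) (v : V) => pure v u).
Proof. by split=> [v|u]; [exact: pure_linear_r | exact: pure_linear_l]. Qed.
Definition swap U V : {linear U ⊗ V -> V ⊗ U} := tensor_lift (@swap_bilinear U V).
Lemma swapE U V (u : U) (v : V) : swap U V (pure u v) = pure v u.
Proof. exact: tensor_lift_pure. Qed.
Lemma swapK U V : cancel (swap U V) (swap V U).
Proof.
move=> x; apply: (tensor_eq (f := swap V U \o swap U V) (g := idfun)) => u v.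
by rewrite /= !swapE.
Qed.

End TensorBasics.

Section Characters.
Variable R : comPzRingType.
Implicit Types U V W F G J : lmodType R.

Fact zlin_linear U V (f : {linear U -> V}) :
  linear (f : zmodule U -> zmodule V).
Proof. by move=> n x y; rewrite !scalezrE raddfD raddfMz. Qed.
Definition zlin U V (f : {linear U -> V}) : {linear zmodule U -> zmodule V} :=
  mklin (zlin_linear f).

(** The character module G^+ = Hom_Z(G, Q/Z): a type of its own, because R acts
    on it through G, besides the action of the integers through Q/Z. *)
Definition char G : Type := {linear zmodule G -> QZ}.
HB.instance Definition _ G := GRing.Zmodule.copy (char G) {linear zmodule G -> QZ}.

Definition ap G (x : char G) : G -> QZ := fun u => x u.

Lemma apD G (x : char G) u v : ap x (u + v) = ap x u + ap x v.
Proof. exact: (raddfD x). Qed.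
Lemma ap0 G (x : char G) : ap x 0 = 0. Proof. exact: (raddf0 x). Qed.
Lemma ap_sum G (x : char G) I (r : seq I) (F : I -> G) :
  ap x (\sum_(i <- r) F i) = \sum_(i <- r) ap x (F i).
Proof. exact: (raddf_sum x). Qed.
Lemma addcE G (x y : char G) u : ap (x + y) u = ap x u + ap y u.
Proof. by []. Qed.
Lemma zerocE G u : ap (0 : char G) u = 0. Proof. by []. Qed.
Lemma oppcE G (x : char G) u : ap (- x) u = - ap x u. Proof. by []. Qed.
Lemma sumcE G I (r : seq I) (F : I -> char G) u :
  ap (\sum_(i <- r) F i) u = \sum_(i <- r) ap (F i) u.
Proof. by elim/big_rec2: _ => // i x y _ <-. Qed.
Lemma char_eq G (x y : char G) : ap x =1 ap y -> x = y.
Proof. by move=> e; apply: homP. Qed.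

Section MkChar.
Variables (G : lmodType R) (f : G -> QZ).
Hypothesis fD : forall u v, f (u + v) = f u + f v.
Fact mkchar_linear : linear (f : zmodule G -> QZ).
Proof.
have f0 : f 0 = 0 by apply: (addIr (f 0)); rewrite -fD !add0r.
have fN u : f (- u) = - f u by apply: (addIr (f u)); rewrite -fD !addNr.
have fM (n : nat) u : f (u *+ n) = n%:Z *: f u.
  elim: n => [|n IHn]; first by rewrite scale0r.
  by rewrite mulrS fD IHn intS scalerDl scale1r.
move=> n x y; rewrite fD; congr (_ + _); rewrite scalezrE.
by case: n => n; rewrite ?NegzE -?pmulrn -?nmulrn ?fN fM // scaleNr.
Qed.
Definition mkchar : char G := mklin mkchar_linear.
Lemma mkcharE u : ap mkchar u = f u. Proof. by []. Qed.
End MkChar.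

Fact char_scale_add G (a : R) (x : char G) u v :
  ap x (a *: (u + v)) = ap x (a *: u) + ap x (a *: v).
Proof. by rewrite scalerDr apD. Qed.
Definition char_scale G a (x : char G) : char G := mkchar (char_scale_add a x).

Fact char_scaleA G a b (x : char G) : char_scale a (char_scale b x) = char_scale (a * b) x.
Proof. by apply: char_eq => u; rewrite !mkcharE scalerA mulrC. Qed.
Fact char_scale1 G : left_id 1 (@char_scale G).
Proof. by move=> x; apply: char_eq => u; rewrite mkcharE scale1r. Qed.
Fact char_scaleDr G : right_distributive (@char_scale G) +%R.
Proof. by move=> a x y; apply: char_eq => u; rewrite addcE !mkcharE addcE. Qed.
Fact char_scaleDl G x : {morph (@char_scale G)^~ x : a b / a + b}.
Proof. by move=> a b; apply: char_eq => u; rewrite addcE !mkcharE scalerDl apD. Qed.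
HB.instance Definition _ G := GRing.Zmodule_isLmodule.Build R (char G)
  (@char_scaleA G) (@char_scale1 G) (@char_scaleDr G) (@char_scaleDl G).

Lemma scalecE G a (x : char G) u : ap (a *: x) u = ap x (a *: u).
Proof. by []. Qed.

Definition capE := (scalecE, addcE, zerocE, oppcE).

Fact char_map_add U V (f : {linear U -> V}) (x : char V) u v :
  ap x (f (u + v)) = ap x (f u) + ap x (f v).
Proof. by rewrite linearD apD. Qed.
Definition char_map_fun U V (f : {linear U -> V}) x : char U := mkchar (char_map_add f x).
Fact char_map_linear U V (f : {linear U -> V}) : linear (char_map_fun f).
Proof. by move=> a x y; apply: char_eq => u; rewrite !mkcharE !capE mkcharE linearZZ. Qed.
Definition char_map U V (f : {linear U -> V}) : {linear char V -> char U} :=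
  mklin (char_map_linear f).
Lemma char_mapE U V (f : {linear U -> V}) x u : ap (char_map f x) u = ap x (f u).
Proof. by []. Qed.

(** Q/Z is injective over the integers; no linearity over R is asked of the
    extension, which is why it exists for every f. *)
Lemma char_factor U V (f : {linear U -> V}) (x : char U) :
  (forall u, f u = 0 -> ap x u = 0) -> exists y : char V, forall u, ap y (f u) = ap x u.
Proof.
move=> fx; pose P (v : zmodule V) z := exists2 u, v = f u & z = ap x u.
have [||y yP] := @baer_extend _ QZ (zmodule V) P qz_baer.
- split; first by exists 0; rewrite ?linear0 ?ap0.
  move=> n _ _ _ _ [u -> ->] [u' -> ->]; exists (n *: (u : zmodule U) + u').
    by rewrite -(linearP (zlin f)).
  by rewrite -(linearP x).
- by move=> z [u /esym/fx e ->].
by exists y => u; apply/esym/yP; exists u.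
Qed.

Lemma char_separates U V (f : {linear U -> V}) v : (forall u, f u <> v) ->
  exists x : char V, (forall u, ap x (f u) = 0) /\ ap x v <> 0.
Proof.
move=> nfv.
have AP : submodule_set (fun w : zmodule V => exists u, f u = w).
  split; first by exists 0; rewrite linear0.
  move=> n _ _ [u <-] [u' <-]; exists (n *: (u : zmodule U) + u').
  exact: (linearP (zlin f)).
have [[u /nfv//]|x [xA xv]] := @qz_separates _ (Submodule AP) v.
by exists x; split=> // u; apply: xA; exists u.
Qed.

Lemma char_separates0 V (v : V) : v <> 0 -> exists x : char V, ap x v <> 0.
Proof.
move=> v0; have [u|x [_ xv]] := @char_separates V V \0 v; last by exists x.
exact/nesym.
Qed.

Lemma transpose U F (k : {linear U -> char F}) :
  exists t : {linear F -> char U}, forall f u, ap (t f) u = ap (k u) f.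
Proof.
have tD f u v : ap (k (u + v)) f = ap (k u) f + ap (k v) f by rewrite linearD.
have tl : linear (fun f => mkchar (tD f)).
  move=> a f g; apply: char_eq => u.
  by rewrite !capE !mkcharE linearZZ apD -scalecE.
by exists (mklin tl).
Qed.

Fact char_at1_add G (L : {linear G -> char R^o}) u v :
  ap (L (u + v)) 1 = ap (L u) 1 + ap (L v) 1.
Proof. by rewrite linearD. Qed.
(** The isomorphism Hom_R(G, R^+) = G^+, in one direction. *)
Definition char_at1 G (L : {linear G -> char R^o}) : char G := mkchar (char_at1_add L).

(** With [hom_of_char], the adjunction (F ⊗ V)^+ = Hom(V, F^+). Tensor products
    only represent bilinear maps to R-modules, so the pairing is first lifted to
    the module R^+ and then evaluated at 1. *)
Lemma tensor_char F V (k : {linear V -> char F}) :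
  exists x : char (F ⊗ V), forall f v, ap x (pure f v) = ap (k v) f.
Proof.
have bD f v (r s : R^o) : ap (k v) ((r + s) *: f) = ap (k v) (r *: f) + ap (k v) (s *: f).
  by rewrite scalerDl apD.
pose b f v : char R^o := mkchar (bD f v).
have bb : @is_bilinear R F V (char R^o) b.
  split=> [v a f g|f a v w]; apply: char_eq => r; rewrite !capE !mkcharE.
    by rewrite scalerDr apD scalerA mulrC.
  rewrite linearP !capE scalerA; congr (ap _ (_ *: _) + _); exact: mulrC.
pose L : {linear F ⊗ V -> char R^o} := tensor_lift bb.
exists (char_at1 L) => f v.
by rewrite mkcharE /= tensor_lift_pure mkcharE scale1r.
Qed.

Lemma hom_of_char F V (x : char (F ⊗ V)) :
  exists k : {linear V -> char F}, forall f v, ap (k v) f = ap x (pure f v).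
Proof.
have kD v f g : ap x (pure (f + g) v) = ap x (pure f v) + ap x (pure g v).
  by rewrite pureDl apD.
have kl : linear (fun v => mkchar (kD v)).
  move=> a v w; apply: char_eq => f; rewrite !capE !mkcharE.
  by rewrite pureDr apD pureZr pureZl.
by exists (mklin kl).
Qed.

(** An x outside the image of F ⊗ U is separated from it by a character of
    F ⊗ V. The corresponding map V -> F^+ kills f, hence factors through g, so the
    character also kills x, which maps to 0 in F ⊗ W. *)
Lemma tensor_exact F U V W (f : {linear U -> V}) (g : {linear V -> W}) :
  (forall k : {linear V -> char F}, (forall u, k (f u) = 0) ->
     exists k' : {linear W -> char F}, forall v, k v = k' (g v)) ->
  forall x : F ⊗ V, tensor_map idfun g x = 0 ->
  exists y : F ⊗ U, tensor_map idfun f y = x.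
Proof.
move=> H x gx; apply: contrapT => nx.
have [u fu|c [cf cx]] := @char_separates _ _ (tensor_map (idfun : {linear F -> F}) f) x.
  by apply: nx; exists u.
have [k kP] := hom_of_char c.
have [u|k' k'P] := H k.
  by apply: char_eq => a; rewrite kP -[a]/(idfun a) -tensor_mapE cf.
have [c' c'P] := tensor_char k'.
apply: cx; rewrite -[RHS](ap0 c') -gx; clear -c'P k'P kP.
rewrite [x]pure_span linear_sum !ap_sum; apply: eq_bigr => p _.
by rewrite tensor_mapE /= c'P -k'P kP.
Qed.

Lemma tensor_injective F V W (g : {linear V -> W}) :
  (forall k : {linear V -> char F},
     exists k' : {linear W -> char F}, forall v, k v = k' (g v)) ->
  injective (tensor_map idfun g : F ⊗ V -> F ⊗ W).
Proof.
move=> H; apply: raddf_inj => x gx.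
have [//|y <-] := @tensor_exact F V V W \0 g _ x gx.
rewrite [y]pure_span linear_sum big1 // => p _.
by rewrite tensor_mapE pure0r.
Qed.

Lemma baer_factor J V W (g : {linear V -> W}) (k : {linear V -> J}) :
  baer J -> (forall v, g v = 0 -> k v = 0) ->
  exists k' : {linear W -> J}, forall v, k v = k' (g v).
Proof.
move=> Jb gk; pose P w z := exists2 v, w = g v & z = k v.
have [||k' k'P] := @baer_extend _ J W P Jb.
- split; first by exists 0; rewrite linear0.
  by move=> a _ _ _ _ [v -> ->] [v' -> ->]; exists (a *: v + v'); rewrite linearP.
- by move=> z [v /esym/gk e ->].
by exists k' => v; apply: k'P; exists v.
Qed.

Lemma surj_factor J V W (g : {linear V -> W}) (k : {linear V -> J}) :
  (forall w, exists v, g v = w) -> (forall v, g v = 0 -> k v = 0) ->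
  exists k' : {linear W -> J}, forall v, k v = k' (g v).
Proof.
move=> gs gk; pose P w z := exists2 v, w = g v & z = k v.
have [|||k' [_ k'P]] := @linear_of_rel _ W J P.
- split; first by exists 0; rewrite linear0.
  by move=> a _ _ _ _ [v -> ->] [v' -> ->]; exists (a *: v + v'); rewrite linearP.
- by move=> z [v /esym/gk e ->].
- by move=> w; have [v <-] := gs w; exists (k v), v.
by exists k' => v; apply: k'P; exists v.
Qed.

Lemma tensor_right_exact F U V W (f : {linear U -> V}) (g : {linear V -> W}) :
  (forall w, exists v, g v = w) -> (forall v, g v = 0 -> exists u, f u = v) ->
  forall x : F ⊗ V, tensor_map idfun g x = 0 ->
  exists y : F ⊗ U, tensor_map idfun f y = x.
Proof.
move=> gs fg; apply: tensor_exact => k kf; apply: surj_factor => // v /fg[u <-].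
exact: kf.
Qed.

(** A map I -> F^+ is a character of F ⊗ I, and it extends to a character of
    F ⊗ R = F. *)
Lemma ideal_flat_baer F :
  (forall I : submodule R^o, injective (tensor_map idfun (incl I) : F ⊗ sub I -> F ⊗ R^o)) ->
  baer (char F).
Proof.
move=> Fi P Pl Pf.
have Ip : submodule_set (fun a : R^o => exists y, P a y).
  split; first by exists 0; apply: Pl.1.
  by move=> a x x' [y Py] [y' Py']; exists (a *: y + y'); apply: Pl.2.
have [|||k [_ kP]] := @linear_of_rel _ (sub (Submodule Ip)) (char F) (fun a y => P (incl _ a) y).
- split; first by rewrite linear0; apply: Pl.1.
  by move=> a x x' y y' Py Py'; rewrite linearP; apply: Pl.2.
- by move=> y; rewrite linear0; apply: Pf.
- by move=> a; apply: (subP a).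
have [c cP] := tensor_char k.
have [x x0|d dP] := @char_factor _ _ (tensor_map idfun (incl (Submodule Ip))) c.
  have -> : x = 0 by apply: (Fi (Submodule Ip)); rewrite linear0.
  by rewrite ap0.
have pD u v : ap d (pure (u + v) (1 : R^o)) = ap d (pure u (1 : R^o)) + ap d (pure v (1 : R^o)).
  by rewrite pureDl apD.
exists (@mkchar F (fun u => ap d (pure u (1 : R^o))) pD) => a y Pay.
apply: char_eq => u; rewrite capE mkcharE.
have Ia : Submodule Ip a by exists y.
rewrite (kP (to_sub Ia) y) // -cP -dP tensor_mapE /= pureZl -pureZr.
by congr (ap d (pure _ _)); rewrite /GRing.scale /= mulr1.
Qed.

Lemma flat_baer F : flat F -> baer (char F).
Proof. by move=> Ff; apply: ideal_flat_baer => I; apply: Ff; apply: incl_inj. Qed.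

(** Together with [flat_baer], Lambek's criterion. *)
Lemma baer_flat F : baer (char F) -> flat F.
Proof.
move=> Fb A B f fi; apply: tensor_injective => k; apply: baer_factor => // v.
by rewrite -(linear0 f) => /fi ->; rewrite linear0.
Qed.

Lemma flat_exact F U V W (f : {linear U -> V}) (g : {linear V -> W}) :
  flat F -> (forall v, g v = 0 -> exists u, f u = v) ->
  forall x : F ⊗ V, tensor_map idfun g x = 0 ->
  exists y : F ⊗ U, tensor_map idfun f y = x.
Proof.
move=> /flat_baer Fb fg; apply: tensor_exact => k kf; apply: baer_factor => // v.
by move=> /fg[u <-].
Qed.

End Characters.

(** * Short exact sequences, flat quotients and cotorsion modules *)

Section ShortExact.
Variable R : comPzRingType.
Implicit Types A B G F J K N P T U V W Y Z : lmodType R.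

Definition ses A B G (i : {linear A -> B}) (p : {linear B -> G}) :=
  [/\ injective i, forall g, exists b, p b = g
    & forall b, p b = 0 <-> exists a, i a = b].

Fact ker_submodule U V (f : {linear U -> V}) : submodule_set (fun x => f x = 0).
Proof. by split; [exact: linear0 | move=> a x y fx fy; rewrite linearP fx fy scaler0 addr0]. Qed.
Definition ker U V (f : {linear U -> V}) := Submodule (ker_submodule f).

Fact im_submodule U V (f : {linear U -> V}) : submodule_set (fun y => exists x, f x = y).
Proof.
split; first by exists 0; rewrite linear0.
by move=> a _ _ [x <-] [y <-]; exists (a *: x + y); rewrite linearP.
Qed.
Definition im U V (f : {linear U -> V}) := Submodule (im_submodule f).

Lemma ses_ker B G (p : {linear B -> G}) :
  (forall g, exists b, p b = g) -> ses (incl (ker p)) p.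
Proof.
move=> ps; split=> [|//|b]; first exact: incl_inj.
by split=> [pb|[a <-]]; [exists (to_sub (pb : ker p b)) | exact: (subP a)].
Qed.

Lemma ses_coker A B (i : {linear A -> B}) : injective i -> ses i (pr (im i)).
Proof. by move=> ii; split=> // [|b]; [exact: pr_surj | exact: (pr_eq0 (im i))]. Qed.

Lemma ses_comp0 A B G (i : {linear A -> B}) (p : {linear B -> G}) a :
  ses i p -> p (i a) = 0.
Proof. by case=> _ _ e; apply/e; exists a. Qed.

Lemma linear_inj U V (f : {linear U -> V}) : (forall u, f u = 0 -> u = 0) -> injective f.
Proof. exact: raddf_inj. Qed.

Lemma inj_factor Z A B (i : {linear A -> B}) (k : {linear Z -> B}) :
  injective i -> (forall z, exists a, i a = k z) ->
  exists k' : {linear Z -> A}, forall z, i (k' z) = k z.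
Proof.
move=> ii ki; have [|||k' [k'P _]] := @linear_of_rel _ Z A (fun z a => i a = k z).
- by split=> [|a x x' y y' e e']; rewrite ?linear0 ?linearP ?e ?e'.
- by move=> a; rewrite linear0 -(linear0 i) => /ii.
- by [].
by exists k'.
Qed.

(** J is a direct summand of J1 x J2. *)
Lemma baer_retract J J1 J2 (k1 : {linear J -> J1}) (l1 : {linear J1 -> J})
    (k2 : {linear J -> J2}) (l2 : {linear J2 -> J}) :
  baer J1 -> baer J2 -> (forall y, y = l1 (k1 y) + l2 (k2 y)) -> baer J.
Proof.
move=> b1 b2 kl P Pl Pf.
have H J' (k : {linear J -> J'}) : baer J' ->
    exists x, forall a y, P a y -> k y = (a : R) *: x.
  move=> /(_ (fun a z => exists2 y, P a y & z = k y))[||x xP].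
  - split; first by exists 0; [exact: Pl.1 | rewrite linear0].
    move=> a x x' _ _ [y Py ->] [y' Py' ->]; exists (a *: y + y'); last by rewrite linearP.
    exact: Pl.2.
  - by move=> z [y /Pf-> ->]; rewrite linear0.
  by exists x => a y Py; apply: xP; exists y.
have [x1 x1P] := H _ k1 b1; have [x2 x2P] := H _ k2 b2.
exists (l1 x1 + l2 x2) => a y Py.
by rewrite {1}[y]kl (x1P _ _ Py) (x2P _ _ Py) !linearZZ scalerDr.
Qed.

(** As G^+ is injective, 0 -> G^+ -> B^+ -> A^+ -> 0 splits. *)
Lemma char_split A B G (i : {linear A -> B}) (p : {linear B -> G}) :
  ses i p -> flat G ->
  exists (s : {linear char A -> char B}) (r : {linear char B -> char G}),
    (forall x, char_map i (s x) = x) /\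
    (forall y, y = char_map p (r y) + s (char_map i y)).
Proof.
move=> [ii ps ex] /flat_baer Gb.
have pinj x : char_map p x = 0 -> x = 0.
  move=> px0; apply: char_eq => g; have [b <-] := ps g.
  by rewrite -char_mapE px0.
have [k|r rP] := @baer_factor _ _ _ _ (char_map p) idfun Gb; first exact: pinj.
have pfac y : char_map i y = 0 -> exists x, char_map p x = y.
  move=> iy; have [u /ex[a <-]|x xP] := @char_factor _ _ _ p y.
    by rewrite -char_mapE iy.
  by exists x; apply: char_eq.
pose P (x : char A) (y : char B) := char_map i y = x /\ r y = 0.
have [|||s [sP _]] := @linear_of_rel _ _ _ P.
- split; first by split; rewrite linear0.
  move=> a x x' y y' [ix rx] [ix' rx']; split; first by rewrite linearP ix ix'.
  by rewrite linearP rx rx' scaler0 addr0.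
- by move=> y [/pfac[x <-]]; rewrite -rP /= => ->; rewrite linear0.
- move=> x; have [u|y yP] := @char_factor _ _ _ i x.
    by rewrite -(linear0 i) => /ii ->; rewrite ap0.
  have iy : char_map i y = x by apply: char_eq => u; rewrite char_mapE yP.
  have ip z : char_map i (char_map p z) = 0.
    by apply: char_eq => a; rewrite !char_mapE (_ : p (i a) = 0) ?ap0 //; apply/ex; exists a.
  exists (y - char_map p (r y)); split; first by rewrite linearB /= ip subr0.
  by rewrite linearB /= -rP subrr.
exists s, r; split=> [x|y]; first exact: (sP x).1.
have [|x xP] := pfac (y - s (char_map i y)).
  by rewrite linearB /= (sP _).1 subrr.
have -> : r y = x.
  rewrite -[y](subrK (s (char_map i y))) -xP linearD /= (sP _).2 addr0.
  by rewrite -rP.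
by rewrite xP subrK.
Qed.

(** The transpose P -> A^+ of a map A -> P^+ lifts along the surjection
    B^+ -> A^+. *)
Lemma projective_flat P : projective P -> flat P.
Proof.
move=> Pp A B g gi; apply: tensor_injective => k.
have [t tP] := transpose k.
have [|t' t'P] := Pp _ _ (char_map g) t.
  move=> x; have [u|y yP] := @char_factor _ _ _ g x.
    by rewrite -(linear0 g) => /gi ->; rewrite ap0.
  by exists y; apply: char_eq.
have [k' k'P] := transpose t'.
by exists k' => v; apply: char_eq => u; rewrite k'P -char_mapE t'P tP.
Qed.

Lemma flat_kernel A B G (i : {linear A -> B}) (p : {linear B -> G}) :
  ses i p -> flat B -> flat G -> flat A.
Proof.
move=> ip /flat_baer Bb /(char_split ip)[s [_ [sP _]]]; apply: baer_flat.
apply: (@baer_retract _ _ _ s (char_map i) s \0 Bb Bb) => y.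
by rewrite /= sP addr0.
Qed.

Lemma flat_extension A B G (i : {linear A -> B}) (p : {linear B -> G}) :
  ses i p -> flat A -> flat G -> flat B.
Proof.
move=> ip /flat_baer Ab Gf; have [s [r [_ rP]]] := char_split ip Gf.
by apply: baer_flat; apply: (baer_retract (flat_baer Gf) Ab rP).
Qed.

Lemma flat_retract A B (i : {linear A -> B}) (p : {linear B -> A}) :
  cancel i p -> flat B -> flat A.
Proof.
move=> ip /flat_baer Bb; apply: baer_flat.
apply: (@baer_retract _ _ _ (char_map p) (char_map i) (char_map p) \0 Bb Bb) => y.
by rewrite addr0; apply: char_eq => u; rewrite !char_mapE ip.
Qed.

(** Transpose h to a map J -> A^+, compose it with the section A^+ -> B^+ given by
    the flat cokernel, and transpose back. *)
Lemma dual_extend A B G J (i : {linear A -> B}) (p : {linear B -> G}) (h : {linear A -> char J}) :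
  ses i p -> flat G -> exists h' : {linear B -> char J}, forall a, h a = h' (i a).
Proof.
move=> ip /(char_split ip)[s [_ [sP _]]].
have [t tP] := transpose h.
have [h' h'P] := transpose (s \o t : {linear _ -> _}).
exists h' => a; apply: char_eq => x; rewrite h'P /= -char_mapE sP.
by rewrite tP.
Qed.

(** The only case of Tor_1(F, G) = 0 that is needed. *)
Lemma flat_quotient_injective A B G F (i : {linear A -> B}) (p : {linear B -> G}) :
  ses i p -> flat G -> injective (tensor_map idfun i : F ⊗ A -> F ⊗ B).
Proof.
by move=> ip Gf; apply: tensor_injective => k; apply: (dual_extend k ip Gf).
Qed.

(** Equivalent to Ext^1(G, T) = 0 for all flat G. *)
Definition cotorsion T := forall A B G (i : {linear A -> B}) (p : {linear B -> G}),
  ses i p -> flat G -> forall h : {linear A -> T},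
  exists h' : {linear B -> T}, forall a, h a = h' (i a).

Lemma dual_cotorsion J : cotorsion (char J).
Proof. by move=> A B G i p ip Gf h; apply: (dual_extend h ip Gf). Qed.

Fact ev_add G u (x y : char G) : ap (x + y) u = ap x u + ap y u.
Proof. by []. Qed.
Definition ev_fun G (u : G) : char (char G) := mkchar (fun x y : char G => ev_add u x y).
Fact ev_linear G : linear (@ev_fun G).
Proof.
by move=> a u v; apply: char_eq => x; rewrite capE scalecE !mkcharE apD.
Qed.
Definition ev G : {linear G -> char (char G)} := mklin (@ev_linear G).
Lemma evE G u (x : char G) : ap (ev G u) x = ap x u. Proof. by []. Qed.

Lemma ev_inj G : injective (ev G).
Proof.
apply: linear_inj => u eu; apply: contrapT => /char_separates0[x]; apply.
by rewrite -evE eu.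
Qed.

(** The restriction F^+++ -> F^+ is split by evaluation, so its kernel G^+ is a
    direct summand of the injective module F^+++. *)
Lemma bidual_quotient_flat F G (p : {linear char (char F) -> G}) :
  ses (ev F) p -> flat (char (char F)) -> flat G.
Proof.
move=> [_ ps ex] /flat_baer Tb; apply: baer_flat.
have pinj x : char_map p x = 0 -> x = 0.
  move=> px0; apply: char_eq => g; have [b <-] := ps g.
  by rewrite -char_mapE px0.
pose k : {linear char (char (char F)) -> char (char (char F))} :=
  idfun \- (ev (char F) \o char_map (ev F)).
have [|x|r rP] := @inj_factor _ _ _ (char_map p) k.
- by apply: linear_inj => x; apply: pinj.
- have [u|y yP] := @char_factor _ _ _ p (k x); last by exists y; apply: char_eq.
  move=> /ex[f <-]; rewrite [k x]/= capE oppcE !evE char_mapE.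
  exact: subrr.
apply: (@baer_retract _ _ _ (char_map p) r (char_map p) \0 Tb Tb) => y.
rewrite addr0; apply/esym/eqP; rewrite -subr_eq0; apply/eqP/pinj.
rewrite linearB /= rP /=; suff -> : char_map (ev F) (char_map p y) = 0.
  by rewrite linear0 subr0 subrr.
apply: char_eq => f; rewrite !char_mapE (_ : p (ev F f) = 0) ?ap0 //.
by apply/ex; exists f.
Qed.

Fact pairl_linear U V W (f : {linear U -> V}) (g : {linear U -> W}) :
  linear (fun u => (f u, g u) : V * W).
Proof. by move=> a x y; rewrite !linearP. Qed.
Definition pairl U V W (f : {linear U -> V}) (g : {linear U -> W}) :
  {linear U -> (V * W)%type} := mklin (pairl_linear f g).

Lemma pairlE U V W (f : {linear U -> V}) (g : {linear U -> W}) u :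
  pairl f g u = (f u, g u).
Proof. by []. Qed.

(** F' is the pushout of i and j: pushing out keeps the cokernel N of i and the
    cokernel G of j. *)
Lemma pushout K F N T G (i : {linear K -> F}) (p : {linear F -> N})
    (j : {linear K -> T}) (q : {linear T -> G}) : ses i p -> ses j q ->
  exists F' (i' : {linear T -> F'}) (p' : {linear F' -> N})
    (f : {linear F -> F'}) (g : {linear F' -> G}), ses i' p' /\ ses f g.
Proof.
move=> [ii ps ipe] [ji qs jqe].
pose d : {linear K -> (F * T)%type} := pairl i (\- j).
pose pi := pr (im d).
pose inl : {linear F -> (F * T)%type} := pairl idfun \0.
pose inr : {linear T -> (F * T)%type} := pairl \0 idfun.
have [||p' p'P] := @surj_factor _ _ _ _ pi (p \o fst : {linear (F * T)%type -> N}).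
- exact: pr_surj.
- by move=> u /pr_eq0[k <-] /=; apply/ipe; exists k.
have [||g gP] := @surj_factor _ _ _ _ pi (q \o snd : {linear (F * T)%type -> G}).
- exact: pr_surj.
- move=> u /pr_eq0[k <-] /=; rewrite linearN; apply/eqP; rewrite oppr_eq0.
  by apply/eqP/jqe; exists k.
exists (quo (im d)), (pi \o inr), p', (pi \o inl), g; split; split.
- apply: linear_inj => t /= /pr_eq0[k [/eqP]].
  by rewrite -(linear0 i) (inj_eq ii) => /eqP -> <-; rewrite linear0 oppr0.
- by move=> n; have [x <-] := ps n; exists (pi (x, 0)); rewrite -p'P.
- move=> u; have [[x t] <-] := pr_surj u; rewrite -p'P /=; split=> [/ipe[k <-]|[t' e]].
    exists (t + j k); apply/pr_eq; exists (- k).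
    by congr (_, _); rewrite !linearN /= ?sub0r // opprK addrC addKr.
  have := congr1 p' e; rewrite -!p'P /= linear0 => <- //.
- apply: linear_inj => x /= /pr_eq0[k [<- /eqP]].
  by rewrite oppr_eq0 -(linear0 j) (inj_eq ji) => /eqP ->; rewrite linear0.
- by move=> n; have [t <-] := qs n; exists (pi (0, t)); rewrite -gP.
- move=> u; have [[x t] <-] := pr_surj u; rewrite -gP /=; split=> [/jqe[k <-]|[x' e]].
    exists (x + i k); apply/pr_eq; exists k.
    by congr (_, _); rewrite ?sub0r //= addrC addKr.
  by have := congr1 g e; rewrite -!gP /= linear0 => <-.
Qed.

(** T' = T / K contains N = F / K with quotient T / F = G. *)
Lemma third_iso K F N T G (i : {linear K -> F}) (p : {linear F -> N})
    (j : {linear F -> T}) (q : {linear T -> G}) : ses i p -> ses j q ->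
  exists T' (r : {linear T -> T'}) (f : {linear N -> T'}) (g : {linear T' -> G}),
    ses (j \o i) r /\ ses f g.
Proof.
move=> [ii ps ipe] [ji qs jqe].
pose r := pr (im (j \o i)).
have [//|x /ipe[k <-]|f fP] := @surj_factor _ _ _ _ p (r \o j : {linear F -> _}).
  by apply/pr_eq0; exists k.
have [|t /pr_eq0[k <-]|g gP] := @surj_factor _ _ _ _ r q.
- exact: pr_surj.
- by apply/jqe; exists (i k).
exists (quo (im (j \o i))), r, f, g; split; first exact: ses_coker (inj_comp ji ii).
split.
- apply: linear_inj => n; have [x <-] := ps n; rewrite -fP => /pr_eq0[k /ji <-].
  by apply/ipe; exists k.
- by move=> n; have [t <-] := qs n; exists (r t); rewrite -gP.
- move=> u; have [t <-] := pr_surj u; rewrite -gP; split=> [/jqe[x <-]|[n]].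
    by exists (p x); rewrite -fP.
  have [x <-] := ps n; rewrite -fP => /pr_eq[k e]; apply/jqe; exists (x - i k).
  by rewrite linearB /=; move: e => /= ->; rewrite opprB addrC subrK.
Qed.

(** Pulling u and v back along m gives an extension E of Z by T1. As Z is flat and
    T1 cotorsion, there is a retraction r : E -> T1, and t - u (r (z, t)) is a
    lift of m z that does not depend on the choice of t. *)
Lemma cotorsion_lift T1 T0 T Z (u : {linear T1 -> T0}) (v : {linear T0 -> T})
    (m : {linear Z -> T}) :
  ses u v -> cotorsion T1 -> flat Z -> exists m' : {linear Z -> T0}, forall z, m z = v (m' z).
Proof.
move=> [ui vs uve] T1c Zf.
pose D : {linear (Z * T0)%type -> T} := (m \o fst) \- (v \o snd).
pose E : lmodType R := sub (ker D).
have EP (e : E) : m (incl _ e).1 = v (incl _ e).2.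
  by have /eqP := subP e; rewrite subr_eq0 => /eqP.
have [||i iP] := @inj_factor _ _ _ (incl (ker D)) (pairl \0 u).
- exact: incl_inj.
- move=> t; suff h : ker D (0, u t) by exists (to_sub h).
  by rewrite /ker /= linear0 sub0r (_ : v (u t) = 0) ?oppr0 //; apply/uve; exists t.
have iE : ses i (fst \o incl (ker D) : {linear E -> Z}).
  split.
  + apply: linear_inj => t it; have := iP t; rewrite it linear0 => -[/esym/eqP].
    by rewrite -(linear0 u) (inj_eq ui) => /eqP.
  + move=> z; have [t tP] := vs (m z).
    have h : ker D (z, t) by rewrite /ker /= tP subrr.
    by exists (to_sub h).
  + move=> e; split=> [e1|[t <-]]; last exact: (congr1 fst (iP t)).
    have {}e1 : (incl (ker D) e).1 = 0 := e1.
    have /uve[t tP] : v (incl _ e).2 = 0 by rewrite -EP e1 linear0.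
    exists t; apply: (@incl_inj _ _ (ker D)); rewrite iP pairlE tP.
    by rewrite [RHS]surjective_pairing e1.
have [r rP] := T1c _ _ _ _ _ iE Zf idfun.
pose P z t := exists2 e : E, (incl _ e).1 = z & t = (incl _ e).2 - u (r e).
have [|||m' [m'P _]] := @linear_of_rel _ Z T0 P.
- split; first by exists 0; rewrite ?(linear0 (incl _)) // !linear0 addr0.
  move=> a _ _ _ _ [e <- ->] [e' <- ->]; exists (a *: e + e'); rewrite !linearP //=.
  by rewrite scalerDr addrACA.
- move=> t [e e1 ->].
  have /uve[s sP] : v (incl _ e).2 = 0 by rewrite -EP e1 linear0.
  have -> : e = i s.
    apply: (@incl_inj _ _ (ker D)).
    by rewrite iP pairlE sP [LHS]surjective_pairing e1.
  by rewrite -rP iP pairlE subrr.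
- move=> z; have [t tP] := vs (m z).
  have h : ker D (z, t) by rewrite /ker /= tP subrr.
  by exists (t - u (r (to_sub h))), (to_sub h).
exists m' => z; have [e <- ->] := m'P z.
by rewrite linearB /= (_ : v (u _) = 0) ?subr0 ?EP //; apply/uve; exists (r e).
Qed.

End ShortExact.

(** * Enough projectives and noetherian rings *)

Section FreeModules.
Variable R : comPzRingType.
Implicit Types G M : lmodType R.

Section Free.
Variable X : choiceType.

Definition delta (x : X) : X -> R^o := fun y => (x == y)%:R.
Definition comb (M : lmodType R) (s : X -> M) (l : seq (R * X)) : M :=
  \sum_(p <- l) p.1 *: s p.2.

Lemma comb_cat M (s : X -> M) l l' : comb s (l ++ l') = comb s l + comb s l'.
Proof. exact: big_cat. Qed.
Lemma comb_scale M (s : X -> M) a l :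
  comb s [seq (a * p.1, p.2) | p <- l] = a *: comb s l.
Proof.
by rewrite /comb big_map scaler_sumr; apply: eq_bigr => p _; rewrite scalerA.
Qed.

Fact free_submodule : submodule_set (fun f : X -> R^o => exists l, f = comb delta l).
Proof.
split; first by exists [::]; rewrite /comb big_nil.
move=> a _ _ [l ->] [l' ->]; exists ([seq (a * p.1, p.2) | p <- l] ++ l').
by rewrite comb_cat comb_scale.
Qed.
Definition free : lmodType R := sub (Submodule free_submodule).

Fact free_base_subproof x : Submodule free_submodule (delta x).
Proof. by exists [:: (1, x)]; rewrite /comb big_seq1 scale1r. Qed.
Definition base x : free := to_sub (free_base_subproof x).

(** Linear independence of the functions [delta x], in the form that makes
    [free_extend] well defined. *)
Lemma comb_delta_eq0 M (s : X -> M) l : comb delta l = 0 -> comb s l = 0.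
Proof.
move=> l0; pose u := undup [seq p.2 | p <- l].
have -> : comb s l = \sum_(p <- l) \sum_(x <- u | p.2 == x) p.1 *: s x.
  rewrite /comb big_seq [in RHS]big_seq; apply: eq_bigr => p pl.
  have pu : p.2 \in u by rewrite mem_undup map_f.
  rewrite -big_filter; have -> : [seq x <- u | p.2 == x] = [:: p.2].
    rewrite -(filter_pred1_uniq (undup_uniq _) pu).
    by apply: eq_filter => x; rewrite eq_sym.
  by rewrite big_seq1.
under eq_bigr do rewrite big_mkcond.
rewrite exchange_big /= big1 // => x _.
have := congr1 (fun f : X -> R^o => f x) l0; rewrite /comb fct_sumE /= => e.
rewrite -[RHS](scale0r (s x)) -[X in X *: _](e : _ = 0 :> R) scaler_suml.
apply: eq_bigr => p _; have -> : (p.1 *: delta p.2) x = p.1 * (p.2 == x)%:R by [].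
by case: eqP => _; rewrite ?mulr1 // mulr0 scale0r.
Qed.

Lemma free_extend M (s : X -> M) :
  exists f : {linear free -> M}, forall x, f (base x) = s x.
Proof.
pose P (u : free) (m : M) := exists2 l, incl _ u = comb delta l & m = comb s l.
have [|||f [_ fP]] := @linear_of_rel _ free M P.
- split; first by exists [::]; rewrite ?linear0 /comb big_nil.
  move=> a u u' _ _ [l ul ->] [l' ul' ->].
  exists ([seq (a * p.1, p.2) | p <- l] ++ l'); rewrite comb_cat comb_scale //.
  by rewrite linearP ul ul'.
- by move=> m [l]; rewrite linear0 => /esym/(comb_delta_eq0 s) e ->.
- by move=> u; have [l ul] := subP u; exists (comb s l), l.
exists f => x; apply/esym/fP; exists [:: (1, x)]; rewrite /comb big_seq1 scale1r //.
Qed.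

Lemma free_eq M (f g : {linear free -> M}) : (forall x, f (base x) = g (base x)) -> f =1 g.
Proof.
move=> fg u; have [l ul] := subP u.
have -> : u = comb base l.
  apply: (@incl_inj _ _ (Submodule free_submodule)).
  rewrite [LHS]ul /comb linear_sum; apply: eq_bigr => p _.
  by rewrite linearZZ.
rewrite /comb !linear_sum; apply: eq_bigr => p _.
by rewrite !linearZZ fg.
Qed.

Lemma free_projective : projective free.
Proof.
move=> A B p f ps; have /choice[s sP] : forall x, exists a, p a = f (base x) by move=> x; apply: ps.
have [g gP] := free_extend s; exists g.
apply: (@free_eq _ (p \o g) f) => x /=.
by rewrite gP.
Qed.

End Free.

Lemma enough_projectives G :
  exists (P : lmodType R) (p : {linear P -> G}), projective P /\ forall g, exists x, p x = g.
Proof.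
have [p pP] := @free_extend G G id.
exists (free G), p; split; [exact: free_projective | by move=> g; exists (base g)].
Qed.

Lemma projective_regular : projective (R^o : lmodType R).
Proof.
move=> A B p f ps; have [a aP] := ps (f 1).
have gl : linear (fun r : R^o => (r : R) *: a).
  by move=> r x y; rewrite scalerDl -scalerA.
exists (mklin gl) => r; rewrite mklinE linearZZ aP -linearZZ.
by congr (f _); rewrite /GRing.scale /= mulr1.
Qed.

End FreeModules.

Section Cotorsion.
Variable R : comPzRingType.
Implicit Types A B G F J K N P T U V W Y Z : lmodType R.

(** Ext^1(G, T) embeds in Ext^2(G, T1) = Ext^1(Z, T1) = 0, where Z is the kernel of
    a surjection P -> G from a projective module; Z is flat when G is. Concretely,
    P -> G lifts to B and thereby maps Z to A. The restriction of h to Z lifts to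
    T0 because Z is flat and T1 is cotorsion, and this lift extends to P because
    T0 is cotorsion. The extension and h glue to a map on B, which is generated by
    A and the image of P. *)
Lemma cotorsion_quotient T1 T0 T (u : {linear T1 -> T0}) (v : {linear T0 -> T}) :
  ses u v -> cotorsion T1 -> cotorsion T0 -> cotorsion T.
Proof.
move=> uv T1c T0c A B G i p [ii ps ipe] Gf h.
have [P [q [Pp qs]]] := enough_projectives G.
have [q' q'P] := Pp _ _ p q ps.
have kq := ses_ker qs.
have [//|z|al alP] := @inj_factor _ (sub (ker q)) _ _ i (q' \o incl (ker q)).
  by apply/ipe; rewrite /= q'P; apply: (subP z).
have Zf : flat (sub (ker q)) := flat_kernel kq (projective_flat Pp) Gf.
have [m mP] := cotorsion_lift (h \o al : {linear _ -> T}) uv T1c Zf.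
have [M MP] := T0c _ _ _ _ _ kq Gf m.
pose rel b t := exists a x, b = i a + q' x /\ t = h a + v (M x).
have [|||g [_ gP]] := @linear_of_rel _ B T rel.
- split; first by exists 0, 0; rewrite !linear0 !addr0.
  move=> a _ _ _ _ [b [x [-> ->]]] [b' [x' [-> ->]]].
  exists (a *: b + b'), (a *: x + x').
  by rewrite !linearP; split; rewrite scalerDr addrACA.
- move=> t [a [x [e ->]]].
  have qx : q x = 0.
    rewrite -q'P -[q' x](addKr (i a)) -e addr0 linearN (_ : p (i a) = 0) ?oppr0 //.
    by apply/ipe; exists a.
  have ex : x = incl _ (to_sub (qx : ker q x)) by [].
  have -> : a = - al (to_sub (qx : ker q x)).
    apply: ii; rewrite linearN alP; apply/eqP; rewrite -addr_eq0; exact/eqP/esym.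
  by rewrite {2}ex -MP -mP linearN /= addNr.
- move=> b; have [x xb] := qs (p b).
  have /ipe[a ab] : p (b - q' x) = 0 by rewrite linearB /= q'P xb subrr.
  by exists (h a + v (M x)), a, x; rewrite ab subrK.
exists g => a; apply: gP; exists a, 0; by rewrite !linear0 !addr0.
Qed.

End Cotorsion.

Section Matrices.
Variable R : comPzRingType.
Implicit Types N : lmodType R.

Fact matmul_linear N m n (A : 'I_m -> 'I_n -> R) :
  linear (fun (y : 'I_n -> N) (k : 'I_m) => \sum_i A k i *: y i).
Proof.
move=> c y z; apply/funext => k.
have -> : (c *: (fun k => \sum_i A k i *: y i) + (fun k => \sum_i A k i *: z i)) k
    = c *: (\sum_i A k i *: y i) + \sum_i A k i *: z i by [].
rewrite scaler_sumr -big_split /=; apply: eq_bigr => i _.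
by rewrite scalerDr !scalerA mulrC.
Qed.
Definition matmul N m n (A : 'I_m -> 'I_n -> R) : {linear ('I_n -> N) -> ('I_m -> N)} :=
  mklin (matmul_linear A).
Lemma matmulE N m n (A : 'I_m -> 'I_n -> R) (y : 'I_n -> N) k :
  matmul N A y k = \sum_i A k i *: y i.
Proof. by []. Qed.

Fact coord_inj_linear N n (k : 'I_n) :
  linear (fun (z : N) (k' : 'I_n) => if k' == k then z else 0).
Proof.
move=> c z z'; apply/funext => k'; rewrite [RHS]/GRing.add /= [in RHS]/GRing.scale /=.
by case: eqP; rewrite // scaler0 addr0.
Qed.
Definition coord_inj N n (k : 'I_n) : {linear N -> ('I_n -> N)} :=
  mklin (@coord_inj_linear N n k).
Lemma coord_injE N n (k k' : 'I_n) (z : N) : coord_inj N k z k' = if k' == k then z else 0.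
Proof. by []. Qed.

Fact coord_linear N n (k : 'I_n) : linear (fun v : 'I_n -> N => v k).
Proof. by []. Qed.
Definition coord N n (k : 'I_n) : {linear ('I_n -> N) -> N} := mklin (@coord_linear N n k).

Lemma sum_delta N n (y : 'I_n -> N) i : \sum_j (j == i)%:R *: y j = y i.
Proof.
rewrite (bigD1 i) //= eqxx scale1r big1 ?addr0 // => j /negbTE->.
by rewrite scale0r.
Qed.

Lemma matmul_coord_inj N m n (A : 'I_m -> 'I_n -> R) i (z : N) :
  matmul N A (coord_inj N i z) = \sum_k coord_inj N k (A k i *: z).
Proof.
apply/funext => k; rewrite fct_sumE matmulE.
under [RHS]eq_bigr do rewrite coord_injE eq_sym.
rewrite -big_mkcond big_pred1_eq (bigD1 i) //= coord_injE eqxx.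
rewrite big1 ?addr0 // => j /negbTE; rewrite coord_injE => ->.
by rewrite scaler0.
Qed.

End Matrices.

Section Noetherian.
Variable R : comPzRingType.
Hypothesis hR : noetherian R.

Lemma noetherian_power n (A : submodule ('I_n -> R^o)) :
  exists k (g : 'I_k -> 'I_n -> R^o), (forall i, A (g i)) /\
    forall v, A v -> exists c : 'I_k -> R, v = \sum_i c i *: g i.
Proof.
elim: n A => [|n IHn] A.
  exists 0%N, (fun _ _ => 0); split=> [[]|v _] //.
  by exists (fun _ => 0); rewrite big_ord0; apply/funext; case.
have [k1 [a [aI aP]]] : exists k (e : 'I_k -> R),
    (forall i, exists2 v, A v & v ord0 = e i) /\
    forall x, (exists2 v, A v & v ord0 = x) -> exists c, x = \sum_i c i * e i.
  apply: (hR (I := fun x => exists2 v, A v & v ord0 = x)); split.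
  - by exists 0 => //; apply: submod0.
  - by move=> _ _ [v Av <-] [w Aw <-]; exists (v + w) => //; apply: submodD.
  - by move=> c _ [v Av <-]; exists (c *: v) => //; apply: submodZ.
have /choice[g1 g1P] : forall i, exists v, A v /\ v ord0 = a i.
  by move=> i; have [v] := aI i; exists v.
pose ext (w : 'I_n -> R^o) : 'I_n.+1 -> R^o :=
  fun i => if unlift ord0 i is Some j then w j else 0.
have ext0 w : ext w ord0 = 0 by rewrite /ext unlift_none.
have extS w j : ext w (lift ord0 j) = w j by rewrite /ext liftK.
have extE v : v ord0 = 0 -> v = ext (fun j => v (lift ord0 j)).
  by move=> v0; apply/funext => i; case: (unliftP ord0 i) => [j|] ->; rewrite ?extS ?ext0.
have extl : linear ext.
  move=> c v w; apply/funext => i.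
  have -> : (c *: ext v + ext w) i = c *: ext v i + ext w i by [].
  case: (unliftP ord0 i) => [j|] ->; rewrite ?extS ?ext0 //.
  by rewrite scaler0 addr0.
have e0 : ext 0 = 0 := linear0 (mklin extl).
have A'P : submodule_set (fun w => A (ext w)).
  split; first by rewrite e0; apply: submod0.
  by move=> c v w Av Aw; rewrite extl; apply: submodP.
have [k2 [g2 [g2A g2P]]] := IHn (Submodule A'P).
exists (k1 + k2)%N, (fun i => match fintype.split i with inl j => g1 j | inr j => ext (g2 j) end).
split=> [i|v Av]; first by case: fintype.split => j; [exact: (g1P j).1 | exact: g2A].
have [c cP] := aP _ (ex_intro2 _ _ v Av erefl).
pose v' := v - \sum_i c i *: g1 i.
have Av' : A v' by apply: submodB => //; apply: submod_sum => i _; apply/submodZ/(g1P i).1.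
have v'0 : v' ord0 = 0.
  have -> : v' ord0 = v ord0 - (\sum_i c i *: g1 i) ord0 by [].
  rewrite fct_sumE cP; apply/eqP; rewrite subr_eq0; apply/eqP.
  by apply: eq_bigr => i _; rewrite -(g1P i).2.
have [|d dP] := g2P (fun j => v' (lift ord0 j)); first by rewrite /= -extE.
exists (fun i => match fintype.split i with inl j => c j | inr j => d j end).
rewrite big_split_ord /=.
under eq_bigr do rewrite (unsplitK (inl _)).
under [X in _ + X]eq_bigr do rewrite (unsplitK (inr _)).
rewrite -[v](subrK (\sum_i c i *: g1 i)) -/v' addrC; congr (_ + _).
rewrite (extE _ v'0) dP -[ext]/(mklin extl : _ -> _) linear_sum.
by apply: eq_bigr => i _; rewrite linearZZ.
Qed.

(** An element of J^+ ⊗ I is a sum of tensors phi_i ⊗ a_i, and it is sent to 0 in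
    J^+ if the sum of the a_i phi_i is 0. Let the rows of the matrix g generate the
    relations between the a_i. As J is injective, J -> J^n -> J^m is exact, where
    the first map is multiplication by the a_i and the second one is g. The
    character of J^n with components phi_i kills the image of J, so it factors
    through J^m: phi_i is the sum of the g_ki psi_k. Moving the g_ki across the
    tensor sign shows that the element is 0. *)
Lemma baer_dual_flat (J : lmodType R) : baer J -> flat (char J).
Proof.
move=> Jb; apply: baer_flat; apply: ideal_flat_baer => I; apply: linear_inj => x x0.
pose n := size (repr x); pose phi (i : 'I_n) := (tnth (in_tuple (repr x)) i).1.
pose a (i : 'I_n) := (tnth (in_tuple (repr x)) i).2.
have xE : x = \sum_i pure (phi i) (a i).
  by rewrite {1}[x]pure_span big_tnth.
have rel0 : \sum_i (incl I (a i) : R) *: phi i = 0.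
  have ml : is_bilinear (fun (y : char J) (r : R^o) => (r : R) *: y).
    split=> [r c y z|y c r s]; last by rewrite scalerDl -scalerA.
    by rewrite scalerDr !scalerA mulrC.
  pose L : {linear char J ⊗ R^o -> char J} := tensor_lift ml.
  pose LI : {linear char J ⊗ sub I -> char J} := L \o tensor_map idfun (incl I).
  transitivity (LI x); last by rewrite /= x0 linear0.
  rewrite xE linear_sum; apply: eq_bigr => i _.
  rewrite [LI _](congr1 L (tensor_mapE _ _ _ _)).
  exact/esym/(tensor_lift_pure ml).
pose al (i : 'I_n) : R := incl I (a i).
have SP : submodule_set (fun b : 'I_n -> R^o => \sum_i (b i : R) * al i = 0).
  split; first by rewrite big1 // => i _; rewrite mul0r.
  move=> c b b' e e'.
  transitivity (c * (\sum_i (b i : R) * al i) + \sum_i (b' i : R) * al i); last first.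
    by rewrite e e' mulr0 addr0.
  rewrite mulr_sumr -big_split /=.
  by apply: eq_bigr => i _; rewrite mulrDl mulrA.
have [m [g [gS gP]]] := noetherian_power (Submodule SP).
pose be : {linear ('I_n -> J) -> ('I_m -> J)} := matmul J g.
have exJ y : be y = 0 -> exists z, forall i, y i = al i *: z.
  move=> by0; have {}by0 k : \sum_i (g k i : R) *: y i = 0.
    by have := congr1 (fun f : 'I_m -> J => f k) by0.
  pose P (r : R^o) (z : J) := exists b : 'I_n -> R,
    (r : R) = \sum_i b i * al i /\ z = \sum_i b i *: y i.
  have [||z zP] := Jb P.
  - split.
      by exists (fun=> 0); rewrite !big1 // => i _; rewrite ?mul0r ?scale0r.
    move=> c _ _ _ _ [b [-> ->]] [b' [-> ->]]; exists (fun i => c * b i + b' i).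
    split.
      rewrite -[LHS]/(c * (\sum_i b i * al i) + \sum_i b' i * al i) mulr_sumr -big_split /=.
      by apply: eq_bigr => i _; rewrite mulrDl mulrA.
    rewrite scaler_sumr -big_split /=; apply: eq_bigr => i _.
    by rewrite scalerDl scalerA.
  - move=> z [b [/esym/(gP b)[c cE] ->]].
    have bE i : b i = \sum_k c k * (g k i : R) by rewrite cE fct_sumE.
    under eq_bigr do rewrite bE scaler_suml.
    rewrite exchange_big big1 // => k _ /=.
    under eq_bigr do rewrite -scalerA.
    by rewrite -scaler_sumr by0 scaler0.
  exists z => i; apply/zP; exists (fun j => (j == i)%:R); split; last by rewrite sum_delta.
  exact/esym/(@sum_delta R R^o n al i).
have PhiD (y z : 'I_n -> J) : \sum_i ap (phi i) ((y + z) i) =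
    \sum_i ap (phi i) (y i) + \sum_i ap (phi i) (z i).
  by rewrite -big_split /=; apply: eq_bigr => i _; rewrite -apD.
have [y /exJ[z yz]|psi psiP] := @char_factor _ _ _ be (mkchar PhiD).
  rewrite mkcharE -[RHS](zerocE z) -rel0 sumcE; apply: eq_bigr => i _.
  by rewrite capE yz.
pose Psi k := char_map (coord_inj J k) psi.
have phiE i : phi i = \sum_k (g k i : R) *: Psi k.
  apply: char_eq => z; rewrite sumcE.
  have <- : ap (mkchar PhiD) (coord_inj J i z) = ap (phi i) z.
    rewrite mkcharE (bigD1 i) //= coord_injE eqxx big1 ?addr0 // => j /negbTE.
    by rewrite coord_injE => ->; rewrite ap0.
  rewrite -psiP matmul_coord_inj ap_sum; apply: eq_bigr => k _.
  by rewrite capE char_mapE.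
rewrite xE; under eq_bigr do rewrite phiE pure_suml.
rewrite exchange_big big1 // => k _ /=.
under eq_bigr do rewrite pureZl -pureZr.
rewrite -pure_sumr; have -> : \sum_i (g k i : R) *: a i = 0; last by rewrite pure0r.
apply: (@incl_inj _ _ I); rewrite linear0 linear_sum -[RHS](gS k).
by apply: eq_bigr => i _; rewrite linearZZ.
Qed.

Lemma bidual_flat (F : lmodType R) : flat F -> flat (char (char F)).
Proof. by move=> /flat_baer; apply: baer_dual_flat. Qed.

End Noetherian.

(** * From flat resolutions to proper flat resolutions *)

Section FiniteFlatResolutions.
Variable R : comPzRingType.
Implicit Types A F G K N T Y : lmodType R.

(** A flat resolution 0 -> F_n -> ... -> F_0 -> N -> 0, cut into short exact
    sequences so that it can be rebuilt one kernel at a time. *)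
Fixpoint flat_length n N : Prop :=
  if n is m.+1 then
    exists K F (i : {linear K -> F}) (p : {linear F -> N}),
      [/\ ses i p, flat F & flat_length m K]
  else flat N.

Fixpoint flat_cotorsion_length n T : Prop :=
  if n is m.+1 then
    exists K F (i : {linear K -> F}) (p : {linear F -> T}),
      [/\ ses i p, flat F, cotorsion F & flat_cotorsion_length m K]
  else flat T /\ cotorsion T.

Definition flat_precover F N (p : {linear F -> N}) :=
  flat F /\ forall Y (m : {linear Y -> N}), flat Y ->
    exists m' : {linear Y -> F}, forall y, m y = p (m' y).

Fixpoint proper_length n N : Prop :=
  if n is m.+1 then
    exists K F (i : {linear K -> F}) (p : {linear F -> N}),
      [/\ ses i p, flat_precover p & proper_length m K]
  else flat N.

Lemma flat_cotorsion_length_cotorsion n T : flat_cotorsion_length n T -> cotorsion T.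
Proof.
elim: n T => [|n IHn] T; first by case.
by case=> K [F [i [p [ip _ Fc /IHn Kc]]]]; exact: cotorsion_quotient ip Kc Fc.
Qed.

Lemma flat_cotorsion_length_proper n T : flat_cotorsion_length n T -> proper_length n T.
Proof.
elim: n T => [|n IHn] T; first by case.
case=> K [F [i [p [ip Ff _ Kl]]]]; exists K, F, i, p; split=> //; last exact: IHn.
split=> // Y m Yf.
exact: cotorsion_lift m ip (flat_cotorsion_length_cotorsion Kl) Yf.
Qed.

Hypothesis hR : noetherian R.

(** Induction along the resolution 0 -> K1 -> F -> K -> 0. Embed K1 in T1 and push
    out to 0 -> T1 -> F' -> K -> 0; here F' is an extension of the flat module
    T1 / K1 by F, so it is flat. Then T = F'^++ / T1 contains F' / T1 = K, with
    the flat quotient F'^++ / F', and F'^++ is the first term of its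
    resolution. *)
Lemma flat_cotorsion_embedding n K : flat_length n K ->
  exists T G (j : {linear K -> T}) (q : {linear T -> G}),
    [/\ ses j q, flat G & flat_cotorsion_length n T].
Proof.
elim: n K => [|n IHn] K.
  move=> Kf; have e := ses_coker (@ev_inj _ K).
  exists (char (char K)), (quo (im (ev K))), (ev K), (pr (im (ev K))); split=> //.
    exact: bidual_quotient_flat e (bidual_flat hR Kf).
  by split; [exact: bidual_flat | exact: dual_cotorsion].
case=> K1 [F [i [p [ip Ff /IHn[T1 [G1 [j [q [jq G1f T1l]]]]]]]]].
have [F' [i' [p' [f [g [ip' fg]]]]]] := pushout ip jq.
have F'f : flat F' := flat_extension fg Ff G1f.
have e := ses_coker (@ev_inj _ F').
have [T [r [f' [g' [er fg']]]]] := third_iso ip' e.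
exists T, (quo (im (ev F'))), f', g'; split=> //.
  exact: bidual_quotient_flat e (bidual_flat hR F'f).
exists T1, (char (char F')), (ev F' \o i'), r; split=> //.
  exact: bidual_flat.
exact: dual_cotorsion.
Qed.

(** Embedding the kernel K of F -> N in a cotorsion module T with flat cokernel
    and pushing out makes the kernel cotorsion and keeps F flat; then maps from
    flat modules to N lift. *)
Lemma proper_length_of_flat n N : flat_length n N -> proper_length n N.
Proof.
case: n => // n [K [F [i [p [ip Ff /flat_cotorsion_embedding[T [G [j [q [jq Gf Tl]]]]]]]]]].
have [F' [i' [p' [f [g [ip' fg]]]]]] := pushout ip jq.
exists T, F', i', p'; split=> //; last exact: flat_cotorsion_length_proper.
split=> [|Y m Yf]; first exact: flat_extension fg Ff Gf.
exact: cotorsion_lift m ip' (flat_cotorsion_length_cotorsion Tl) Yf.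
Qed.

End FiniteFlatResolutions.

(** * Lengths of resolutions *)

Section Lengths.

Lemma bar_int_sup (A : set (\bar int)) : exists s, supremums A s.
Proof.
have [[M AM]|nb] := pselect (exists M : int, forall x, A x -> (x <= M%:E)%E); last first.
  exists +oo%E; split=> [x _|u Au]; first exact: leey.
  case: u Au => [M|//|] Au; case: nb; first by exists M.
  by exists 0 => x /Au; rewrite leeNy_eq => /eqP ->; exact: leNye.
have [ex|nA] := pselect (exists j : nat, `[< A (M - j%:Z)%:E >]); last first.
  exists -oo%E; split=> [x Ax|u _]; last exact: leNye.
  case: x Ax (AM x Ax) => [k|//|//] Ak; rewrite lee_fin => kM; case: nA.
  exists `|M - k|%N; apply/asboolP; rewrite gez0_abs ?subr_ge0 //.
  by rewrite subKr.
case: (ex_minnP ex) => j /asboolP Aj jmin; exists (M - j%:Z)%:E; split=> [x Ax|u]; last exact.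
case: x Ax (AM x Ax) => [k||_ _]; [|by []|exact: leNye].
move=> Ak; rewrite lee_fin => kM.
have := jmin `|M - k|%N; rewrite gez0_abs ?subr_ge0 // subKr.
move=> /(_ (asboolT Ak)); rewrite lee_fin -lez_nat gez0_abs ?subr_ge0 //.
by rewrite lerBrDr lerBrDl addrC -lerBrDr.
Qed.

(** The infimum is the supremum of the lower bounds. *)
Lemma bar_int_inf (A : set (\bar int)) : exists s, infimums A s.
Proof.
have [s [sub slb]] := bar_int_sup (lbound A); exists s; split=> [a Aa|l lA].
  by apply: slb => l; apply.
exact: sub.
Qed.

Variable R : comPzRingType.
Implicit Types M N : lmodType R.

Lemma complex_length_le (X : chain_complex R) (n : nat) :
  (complex_length X <= (n%:Z)%:E)%E <-> forall i, (n < i)%N -> zero_module (X i).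
Proof.
rewrite /complex_length /supremum; set A := [set _ | _ in _].
have [A0|/set0P[a Aa]] := eqVneq A set0.
  split=> // _ i ni; apply: contrapT => nz.
  have : A ((i%:Z)%:E) by exists i.
  by rewrite A0.
have [s sA] := bar_int_sup A.
have [ubA lbA] : supremums A (xget -oo%E (supremums A)) by apply: (xgetPex _ (ex_intro _ s sA)).
split=> [le i ni|z].
  apply: contrapT => nz.
  have : ((i%:Z)%:E <= (n%:Z)%:E)%E by apply: le_trans le; apply: ubA; exists i.
  by rewrite lee_fin lez_nat leqNgt ni.
apply: lbA => _ [i nz <-]; rewrite lee_fin lez_nat leqNgt; apply/negP => /z.
exact: nz.
Qed.

(** If no length is at most n, then n + 1 is a lower bound for all of them. *)
Lemma proper_dim_le K M (n : nat) : (proper_dim K M <= (n%:Z)%:E)%E <->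
  exists2 X : augmented M, proper_resolution K X & forall i, (n < i)%N -> zero_module (X i).
Proof.
rewrite /proper_dim /infimum; set A := [set _ | _].
have AP : (exists2 d, A d & (d <= (n%:Z)%:E)%E) <->
    exists2 X : augmented M, proper_resolution K X & forall i, (n < i)%N -> zero_module (X i).
  split=> [[_ [X XP ->] /complex_length_le]|[X XP /complex_length_le Xn]]; first by exists X.
  by exists (complex_length X) => //; exists X.
rewrite -AP; have [A0|/set0P[a Aa]] := eqVneq A set0.
  by split=> // -[d]; rewrite A0.
have [s sA] := bar_int_inf A.
have [lbA ubA] : infimums A (xget +oo%E (infimums A)) by apply: (xgetPex _ (ex_intro _ s sA)).
split=> [le|[d Ad]]; last by apply: le_trans; apply: lbA.
apply: contrapT => nd.
have /ubA/le_trans/(_ le) : lbound A (n.+1%:Z)%:E.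
  move=> d Ad; have {}nd : ~ (d <= (n%:Z)%:E)%E by move=> dn; apply: nd; exists d.
  case: d nd {Ad} => [k|//|[]] //; rewrite ?leey // !lee_fin intS addrC => /negP.
  by rewrite -ltNge lezD1.
by rewrite lee_fin lez_nat ltnn.
Qed.

Lemma bar_int_eq (d e : \bar int) :
  (forall n : nat, (d <= (n%:Z)%:E)%E -> d = e) ->
  (forall n : nat, (e <= (n%:Z)%:E)%E -> d = e) -> d = e.
Proof.
move=> de ed; have large (c : \bar int) : c = +oo%E \/ exists n : nat, (c <= (n%:Z)%:E)%E.
  case: c => [k||]; [right|by left|right]; last by exists 0%N.
  by exists `|k|%N; rewrite lee_fin abszE ler_norm.
case: (large d) => [dE|[n /de//]]; case: (large e) => [eE|[n /ed//]].
by rewrite dE eE.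
Qed.

Lemma hom_exactP (Y : lmodType R) (Z : chain_complex R) : is_exact (hom_complex Y Z) <->
  (forall f : {linear Y -> Z 0%N}, exists g : {linear Y -> Z 1%N},
     forall y, f y = boundary Z 0 (g y)) /\
  (forall n (f : {linear Y -> Z n.+1}), (forall y, boundary Z n (f y) = 0) ->
     exists g : {linear Y -> Z n.+2}, forall y, f y = boundary Z n.+1 (g y)).
Proof.
split=> [[e0 e1]|[e0 e1]]; split.
- by move=> f; have [g <-] := e0 f; exists g.
- by move=> n f df; have [|g <-] := e1 n f; [exact: homP | exists g].
- by move=> f; have [g gP] := e0 f; exists g; apply: homP => y; rewrite gP.
- move=> n f df; have [y|g gP] := e1 n f.
    exact: (congr1 (fun h : {linear Y -> Z n} => h y) df).
  by exists g; apply: homP => y; rewrite gP.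
Qed.

Lemma regular_hom (M : lmodType R) (x : M) : exists f : {linear R^o -> M}, f 1 = x.
Proof.
have fl : linear (fun r : R^o => (r : R) *: x).
  by move=> r a y; rewrite scalerDl -scalerA.
by exists (mklin fl); rewrite mklinE scale1r.
Qed.

(** Hom(R, Z) is Z. *)
Lemma hom_regular_exact (Z : chain_complex R) : is_exact (hom_complex R^o Z) -> is_exact Z.
Proof.
move=> /hom_exactP[e0 e1]; split=> [x|n x dx].
  have [f fx] := regular_hom x; have [g gP] := e0 f.
  by exists (g 1); rewrite -gP.
have [f fx] := regular_hom x; have [r|g gP] := e1 n f; last by exists (g 1); rewrite -gP.
have -> : r = r *: (1 : R^o) by rewrite /GRing.scale /= mulr1.
by rewrite !linearZZ fx dx scaler0.
Qed.

Lemma flat_proper_exact M (X : augmented M) :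
  proper_resolution (@flat R) X -> is_exact (aug_complex X).
Proof.
case=> _ /(_ (R^o : lmodType R)) H; apply/hom_regular_exact/H.
exact/projective_flat/projective_regular.
Qed.

Section Shift.
Variables (M : lmodType R) (L : augmented M).

Definition shift_complex : chain_complex R :=
  @ChainComplex R (fun i => L i.+1) (fun i => boundary L i.+1) (fun i => boundaryK (n := i.+1)).

End Shift.

Lemma flat_length_of_exact n M (L : augmented M) :
  exact_resolution (@flat R) n L -> flat_length n M.
Proof.
elim: n M L => [|n IHn] M L [Lf L0 [e0 e1]].
  have ai : injective (aug L).
    apply: linear_inj => x /(e1 0%N x)[y <-].
    by rewrite [y](L0 1%N) // (linear0 (boundary L 0)).
  have [m|k kP] := @inj_factor _ M _ _ (aug L) idfun ai; first exact: e0.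
  exact: flat_retract kP (Lf 0%N isT).
have [|x|b bP] := @inj_factor _ _ _ _ (incl (ker (aug L))) (boundary L 0).
- exact: incl_inj.
- have h : ker (aug L) (boundary L 0 x) by apply: aug_boundary.
  by exists (to_sub h).
exists (sub (ker (aug L))), (L 0%N), (incl (ker (aug L))), (aug L); split.
- exact: ses_ker.
- exact: Lf.
have baug (x : shift_complex L 1%N) : b (boundary (shift_complex L) 0 x) = 0.
  by apply: (@incl_inj _ _ (ker (aug L))); rewrite bP linear0; apply: (boundaryK (c := L)).
apply: (IHn _ (Augmented baug)); split=> [i ni|i ni|].
- exact: Lf.
- exact: L0.
split=> [x|[|i] x /= bx].
- have [y yx] := e1 0%N (incl _ x) (subP x).
  by exists y; apply: (@incl_inj _ _ (ker (aug L))); rewrite bP.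
- by apply: (e1 1%N x); rewrite -[LHS]bP bx linear0.
- exact: (e1 i.+2 x).
Qed.

Definition zero_mod : lmodType R := ('I_0 -> R^o).
Lemma zero_modP : zero_module zero_mod.
Proof. by move=> x; apply/funext; case. Qed.

Lemma zero_flat N : zero_module N -> flat N.
Proof.
move=> z A B f fi; have Az : zero_module (N ⊗ A).
  by apply: tensor_zero_module => u v; rewrite (z u) pure0l.
by move=> x y _; rewrite (Az x) (Az y).
Qed.

Section Concentrated.
Variable M : lmodType R.
Definition conc_obj (i : nat) : lmodType R := if i is 0%N then M else zero_mod.
Definition conc_boundary i : {linear conc_obj i.+1 -> conc_obj i} := \0.
Fact conc_boundaryK i x : conc_boundary i (conc_boundary i.+1 x) = 0.
Proof. by []. Qed.
Definition conc_complex := ChainComplex conc_boundaryK.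
Fact conc_aug (x : conc_complex 1%N) :
  (idfun : {linear conc_complex 0%N -> M}) (boundary conc_complex 0 x) = 0.
Proof. by []. Qed.
Definition concentrated : augmented M := Augmented conc_aug.
End Concentrated.

Section Splice.
Variables (K F M : lmodType R) (i : {linear K -> F}) (p : {linear F -> M}) (X : augmented K).
Hypothesis pi0 : forall k, p (i k) = 0.

Definition splice_obj (n : nat) : lmodType R := if n is m.+1 then X m else F.
Definition splice_boundary n : {linear splice_obj n.+1 -> splice_obj n} :=
  match n with 0%N => (i \o aug X : {linear X 0%N -> F}) | m.+1 => boundary X m end.
Fact splice_boundaryK n x : splice_boundary n (splice_boundary n.+1 x) = 0.
Proof.
case: n x => [|n] x /=; last exact: boundaryK.
by rewrite (aug_boundary (a := X)) linear0.
Qed.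
Definition splice_complex := ChainComplex splice_boundaryK.
Fact splice_aug (x : splice_complex 1%N) : p (boundary splice_complex 0 x) = 0.
Proof. exact: pi0. Qed.
Definition splice : augmented M := Augmented splice_aug.
End Splice.

Lemma proper_of_length n M : proper_length n M ->
  exists2 X : augmented M, proper_resolution (@flat R) X & forall i, (n < i)%N -> zero_module (X i).
Proof.
elim: n M => [|n IHn] M.
  move=> Mf; exists (concentrated M); last by case=> // i _; exact: zero_modP.
  split=> [[|i]|Y Yf]; [exact: Mf | exact/zero_flat/zero_modP | apply/hom_exactP; split].
    by move=> f; exists f.
  move=> [|j] f fd; exists \0 => y; first exact: (fd y).
  exact: zero_modP.
case=> K [F [i [p [ip [Ff pF] /IHn[X [Xf Xp] X0]]]]].
have pi0 k : p (i k) = 0 by exact: ses_comp0 ip.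
have [ii ps ipe] := ip.
exists (splice X pi0); last by case=> // j; exact: X0.
split=> [[|j]|Y Yf]; [exact: Ff | exact: Xf | apply/hom_exactP].
have /hom_exactP[e0 e1] := Xp Y Yf.
split=> [f|[|[|j]] f fd].
- by have [g gP] := pF Y f Yf; exists g.
- have [y|k kP] := inj_factor (k := f) ii; first exact/ipe/fd.
  have [g gP] := e0 k; exists g => y.
  by rewrite -kP gP.
- apply: (e1 0%N f) => y; apply: ii; rewrite linear0; exact: fd.
- exact: (e1 j.+1 f).
Qed.

Lemma proper_flat_of_exact n M (L : augmented M) : noetherian R ->
  exact_resolution (@flat R) n L ->
  exists2 X : augmented M, proper_resolution (@flat R) X & forall i, (n < i)%N -> zero_module (X i).
Proof.
by move=> hR /flat_length_of_exact/(proper_length_of_flat hR)/proper_of_length.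
Qed.

End Lengths.

(** * Detecting modules and resolving C *)

Section FaithfulModules.
Variable R : comPzRingType.
Hypothesis hR : noetherian R.
Implicit Types M N : lmodType R.

Lemma noetherian_max (Q : set (set R)) :
  (forall I, Q I -> is_ideal I) -> (exists I, Q I) ->
  exists I, Q I /\ forall J, Q J -> I `<=` J -> J `<=` I.
Proof.
(* The empty set is allowed only as the union of the empty chain. *)
move=> Qi [I0 QI0]; pose P (X : set R) := X = set0 \/ Q X.
have [F FP Ftot|A [PA Amax]] := @Zorn_bigcup R P; last first.
  have I00 : I0 0 by have [] := Qi _ QI0.
  have {PA} [A0|QA] := PA.
    by case: (Amax I0) => //; [split; rewrite A0 // => /(_ 0 I00) | right].
  exists A; split=> // J QJ AJ; apply: contrapT => nJA; apply: (Amax J) => //.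
  by right.
have [[X0 FX0 QX0]|nQ] := pselect (exists2 X, F X & Q X); last first.
  left; apply/seteqP; split=> // x [X FX Xx]; have [X0|QX] := FP X FX.
    by rewrite X0 in Xx.
  by case: nQ; exists X.
right; set U := \bigcup_(X in F) X.
have Fid X x : F X -> X x -> is_ideal X.
  by move=> FX Xx; have [X0'|/Qi //] := FP X FX; rewrite X0' in Xx.
have Ui : is_ideal U.
  split=> [|x y [X FX Xx] [Y FY Yy]|a x [X FX Xx]].
  - by exists X0 => //; have [] := Qi _ QX0.
  - have [XY|YX] := Ftot _ _ FX FY.
      by exists Y => //; have [_ YD _] := Fid _ _ FY Yy; apply: YD => //; apply: XY.
    by exists X => //; have [_ XD _] := Fid _ _ FX Xx; apply: XD => //; apply: YX.
  - by exists X => //; have [_ _ XM] := Fid _ _ FX Xx; apply: XM.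
have [n [e [eU eP]]] := hR Ui.
have allk k : (k <= n)%N ->
    exists X, [/\ F X, Q X & forall i : 'I_n, (i < k)%N -> X (e i)].
  elim: k => [|k IHk] kn; first by exists X0.
  have [X [FX QX Xe]] := IHk (ltnW kn).
  have [Y FY Ye] := eU (Ordinal kn).
  have QY : Q Y by have [Y0|//] := FP Y FY; rewrite Y0 in Ye.
  have cmp (i : 'I_n) : (i < k.+1)%N -> (i < k)%N \/ i = Ordinal kn.
    rewrite ltnS leq_eqVlt => /orP[/eqP ik|]; [right | by left].
    exact: val_inj.
  have [XY|YX] := Ftot _ _ FX FY.
    by exists Y; split=> // i /cmp[/Xe/XY|->].
  by exists X; split=> // i /cmp[/Xe|->] //; apply: YX.
have [X [FX QX Xe]] := allk n (leqnn n).
suff -> : U = X by [].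
apply/seteqP; split=> [x /eP[a ->]|x Xx]; last by exists X.
have [X00 XD XM] := Qi _ QX.
by elim/big_ind: _ => // i _; apply/XM/Xe.
Qed.

(** A maximal element among the annihilators of nonzero elements is prime. *)
Lemma prime_annihilator M (x0 : M) : x0 <> 0 ->
  exists x : M, x <> 0 /\ forall a b : R, (a * b) *: x = 0 -> a *: x = 0 \/ b *: x = 0.
Proof.
move=> x0n; pose Q (I : set R) := exists2 x : M, x <> 0 & I = [set a | a *: x = 0].
have [I [x xn ->]|| I [[x xn IE] Imax]] := noetherian_max (Q := Q).
- split=> [|a b ax bx|a b bx]; rewrite /= ?scale0r //.
    by rewrite scalerDl ax bx addr0.
  by rewrite -scalerA bx scaler0.
- by exists [set a | a *: x0 = 0]; exists x0.
exists x; split=> // a b abx; have [|bx] := pselect (b *: x = 0); [by right | left].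
have /(_ a) : [set c | c *: (b *: x) = 0] `<=` I.
  apply: Imax; first by exists (b *: x).
  by rewrite IE => c /= cx; rewrite scalerA mulrC -scalerA cx scaler0.
by rewrite IE; apply; rewrite /= scalerA.
Qed.

Variable C : lmodType R.
Hypothesis Cfg : finitely_generated C.
Hypothesis Cfaithful : forall s : R, (forall c : C, s *: c = 0) -> s = 0.

(** Let x have a prime annihilator p, and let e_1, ..., e_n generate C. Suppose that
    s is outside p and s C lies in the span of e_k, ..., e_n. If t e_k is in the
    span D of e_(k+1), ..., e_n for some t outside p, then t s C lies in D.
    Otherwise the coefficient of e_k in s c is determined modulo p, and
    multiplying x by it defines a map C -> R x that is nonzero at e_k. As all maps
    C -> M vanish, the generators can be removed one after the other, until s C = 0
    for some s outside p; this contradicts faithfulness. *)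
Lemma hom_eq0 M : (forall (h : {linear C -> M}) c, h c = 0) -> zero_module M.
Proof.
move=> H x0; apply: contrapT => /prime_annihilator[x [xn xp]].
have [n [e eP]] := Cfg.
have DP k : submodule_set (fun d : C => exists a : 'I_n -> R,
    (forall j : 'I_n, (j < k)%N -> a j = 0) /\ d = \sum_j a j *: e j).
  split.
    by exists (fun=> 0); split=> //; rewrite big1 // => j _; rewrite scale0r.
  move=> c _ _ [a [a0 ->]] [b [b0 ->]]; exists (fun j => c * a j + b j).
  split=> [j jk|]; first by rewrite a0 // b0 // mulr0 addr0.
  rewrite scaler_sumr -big_split; apply: eq_bigr => j _ /=.
  by rewrite scalerDl scalerA.
pose D k := Submodule (DP k).
have step k : (k <= n)%N -> exists s : R, s *: x <> 0 /\ forall c, D k (s *: c).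
  elim: k => [|k IHk] kn.
    exists 1; rewrite scale1r; split=> // c; rewrite scale1r.
    by have [a aP] := eP c; exists a.
  have [s [sx sD]] := IHk (ltnW kn); pose i := Ordinal kn.
  have DS d : D k d -> exists a : R, D k.+1 (d - a *: e i).
    move=> [a [a0 ->]]; exists (a i); exists (fun j => if j == i then 0 else a j); split.
      move=> j; rewrite ltnS leq_eqVlt => /orP[/eqP ji|/a0->]; last by case: ifP.
      by rewrite (_ : j = i) ?eqxx //; apply: val_inj.
    rewrite (bigD1 i) //= addrAC subrr add0r [RHS](bigD1 i) //= eqxx scale0r add0r.
    by apply: eq_bigr => j /negbTE->.
  have [[t [tx tD]]|nt] := pselect (exists t, t *: x <> 0 /\ D k.+1 (t *: e i)).
    exists (t * s); split=> [tsx|c]; first by case: (xp _ _ tsx).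
    have [a aD] := DS _ (sD c).
    rewrite -scalerA -[s *: c](subrK (a *: e i)) scalerDr scalerA mulrC -scalerA.
    by apply: submodD; apply: submodZ.
  have {}nt t : D k.+1 (t *: e i) -> t *: x = 0.
    by move=> tD; apply: contrapT => tx; apply: nt; exists t.
  pose P c y := exists a : R, y = a *: x /\ D k.+1 (s *: c - a *: e i).
  have [|||h [_ hP]] := @linear_of_rel _ C M P.
  - split.
      by exists 0; rewrite !scale0r scaler0 subr0; split=> //; apply: submod0.
    move=> b c c' _ _ [a [-> aD]] [a' [-> aD']]; exists (b * a + a').
    rewrite [in RHS]scalerDl -scalerA; split=> //.
    suff -> : s *: (b *: c + c') - (b * a + a') *: e i =
      b *: (s *: c - a *: e i) + (s *: c' - a' *: e i) by apply: submodP.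
    by rewrite scalerDr scalerBr scalerDl opprD !scalerA [s * b]mulrC addrACA.
  - move=> _ [a [-> ]]; rewrite scaler0 sub0r => /submodN; rewrite opprK.
    exact: nt.
  - by move=> c; have [a aD] := DS _ (sD c); exists (a *: x), a.
  case: sx; rewrite (hP (e i) (s *: x)) ?H //.
  by exists s; rewrite subrr; split=> //; apply: submod0.
have [s [sx sD]] := step n (leqnn n); apply: sx.
suff -> : s = 0 by rewrite scale0r.
apply: Cfaithful => c; have [a [a0 ->]] := sD c.
by rewrite big1 // => j _; rewrite a0 // scale0r.
Qed.

(** If M is nonzero then so is M^+, and a nonzero map C -> M^+ is a nonzero
    character of C ⊗ M. *)
Lemma tensor_eq0 M : (forall (c : C) (m : M), pure c m = 0) -> zero_module M.
Proof.
move=> H m; apply: contrapT => /char_separates0[x]; apply.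
rewrite (_ : x = 0) //; apply: (@hom_eq0 (char M)) => h c.
have [t tP] := transpose h.
have [y yP] := tensor_char t.
by apply: char_eq => u; rewrite -tP -yP H ap0.
Qed.

End FaithfulModules.

Section TensorMaps.
Variable R : comPzRingType.
Implicit Types F U V W : lmodType R.

Lemma tensor_ind U V (P : U ⊗ V -> Prop) : (forall u v, P (pure u v)) -> P 0 ->
  (forall x y, P x -> P y -> P (x + y)) -> forall x, P x.
Proof. by move=> Pp P0 PD x; rewrite [x]pure_span; apply: big_ind. Qed.

Lemma tensor_map_coord_inj F V n k k' (z : F ⊗ V) :
  tensor_map idfun (coord V k) (tensor_map idfun (@coord_inj R V n k') z) =
  if k == k' then z else 0.
Proof.
elim/tensor_ind: z => [u v||x y ex ey]; last by rewrite !linearD ex ey; case: ifP; rewrite ?addr0.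
  rewrite !tensor_mapE -[coord V k _]/(coord_inj V k' v k) coord_injE.
  by case: ifP => _ //; rewrite pure0r.
by rewrite !linear0; case: ifP.
Qed.

Lemma tensor_map_coord F U V n m (A : 'I_m -> 'I_n -> R) k (z : F ⊗ ('I_n -> V)) :
  tensor_map idfun (coord V k) (tensor_map idfun (matmul V A) z) =
  \sum_j A k j *: tensor_map idfun (coord V j) z.
Proof.
elim/tensor_ind: z => [u v||x y ex ey].
- rewrite !tensor_mapE -[coord V k _]/(\sum_j A k j *: v j) pure_sumr.
  by apply: eq_bigr => j _; rewrite tensor_mapE pureZr.
- by rewrite !linear0 big1 // => j _; rewrite linear0 scaler0.
- rewrite !linearD /= ex ey -big_split; apply: eq_bigr => j _.
  by rewrite linearD scalerDr.
Qed.

Lemma tensor_matmul_inj F V n m (A : 'I_m -> 'I_n -> R) k (z : F ⊗ V) :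
  tensor_map idfun (matmul V A) (tensor_map idfun (@coord_inj R V n k) z) =
  \sum_l tensor_map idfun (@coord_inj R V m l) (A l k *: z).
Proof.
elim/tensor_ind: z => [u v||x y ex ey].
- rewrite !tensor_mapE matmul_coord_inj pure_sumr; apply: eq_bigr => l _.
  by rewrite [RHS]linearZZ tensor_mapE linearZZ pureZr.
- by rewrite !linear0 big1 // => j _; rewrite scaler0 linear0.
- rewrite !linearD /= ex ey -big_split; apply: eq_bigr => j _.
  by rewrite scalerDr linearD.
Qed.

(** Flatness applied to U -> V^n -> V^m, under the identification of F ⊗ V^n with
    (F ⊗ V)^n; only its splitting by injections and coordinates is used. *)
Lemma flat_tuples F U V n m (f : {linear U -> ('I_n -> V)}) (B : 'I_m -> 'I_n -> R) :
  flat F -> (forall v, matmul V B v = 0 -> exists u, f u = v) ->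
  forall v : 'I_n -> F ⊗ V, matmul (F ⊗ V) B v = 0 ->
  exists y : F ⊗ U, forall k, v k = tensor_map idfun (coord V k) (tensor_map idfun f y).
Proof.
move=> Ff fB v Bv.
pose w := \sum_k tensor_map (idfun : {linear F -> F}) (coord_inj V k) (v k).
have [|y yw] := flat_exact Ff fB (x := w).
  rewrite linear_sum; under eq_bigr do rewrite tensor_matmul_inj.
  rewrite exchange_big big1 // => l _ /=.
  rewrite -linear_sum (_ : \sum_i _ = 0) ?linear0 //.
  exact: (congr1 (fun g : 'I_m -> F ⊗ V => g l) Bv).
exists y => k; rewrite yw linear_sum.
under eq_bigr do rewrite tensor_map_coord_inj eq_sym.
by rewrite -big_mkcond big_pred1_eq.
Qed.

End TensorMaps.

Section Resolution.
Variable R : comPzRingType.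
Implicit Types C F N U V : lmodType R.

(** A resolution of C by finitely generated free modules. The free modules consist
    of row vectors and [bd i] is the matrix of the boundary R^(rk (i+1)) -> R^(rk i);
    thus Hom of the resolution to N consists of the tuples N^(rk i), with the
    boundary matrices acting on column vectors. *)
Record free_resolution C := FreeResolution {
  rk : nat -> nat;
  bd : forall i, 'I_(rk i.+1) -> 'I_(rk i) -> R;
  gen : 'I_(rk 0) -> C;
  gen_span : forall c, exists b, c = \sum_j b j *: gen j;
  bd_gen : forall k, \sum_j bd k j *: gen j = 0;
  gen_relations : forall b : 'I_(rk 0) -> R, \sum_j b j *: gen j = 0 ->
    exists c, forall j, b j = \sum_k c k * bd k j;
  bd_bd : forall i (k : 'I_(rk i.+2)) (j : 'I_(rk i)), \sum_l bd k l * bd l j = 0;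
  bd_relations : forall i (b : 'I_(rk i.+1) -> R), (forall j, \sum_l b l * bd l j = 0) ->
    exists c, forall l, b l = \sum_k c k * bd k l
}.
Arguments bd {C} f i k j : rename.
Arguments gen {C} f j : rename.

Lemma free_resolution_exists C : noetherian R -> finitely_generated C ->
  exists X : free_resolution C, True.
Proof.
move=> hR [n0 [e eP]].
have syz (N : lmodType R) n (a : 'I_n -> N) : exists k (B : 'I_k -> 'I_n -> R),
    (forall i, \sum_j B i j *: a j = 0) /\
    forall b : 'I_n -> R, \sum_j b j *: a j = 0 -> exists c, forall j, b j = \sum_i c i * B i j.
  have SP : submodule_set (fun b : 'I_n -> R^o => \sum_j (b j : R) *: a j = 0).
    split; first by rewrite big1 // => i _; rewrite scale0r.
    move=> c b b' ab ab'.
    transitivity (c *: (\sum_i (b i : R) *: a i) + \sum_i (b' i : R) *: a i); last first.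
      by rewrite ab ab' scaler0 addr0.
    rewrite scaler_sumr -big_split /=.
    by apply: eq_bigr => i _; rewrite scalerDl scalerA.
  have [k [g [gS gP]]] := noetherian_power hR (Submodule SP).
  exists k, g; split=> // b /gP[c ->]; exists c => j.
  by rewrite fct_sumE.
pose mat := {n : nat & {m : nat & 'I_m -> 'I_n -> R}}.
pose src (s : mat) := projT1 (projT2 s); pose tgt (s : mat) := projT1 s.
pose coef (s : mat) : 'I_(src s) -> 'I_(tgt s) -> R := projT2 (projT2 s).
have nxt_ex : forall s : mat, exists kB : {k : nat & 'I_k -> 'I_(src s) -> R},
    (forall i j, \sum_l projT2 kB i l * coef s l j = 0) /\
    forall b : 'I_(src s) -> R, (forall j, \sum_l b l * coef s l j = 0) ->
      exists c, forall l, b l = \sum_i c i * projT2 kB i l.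
  move=> s; have [k [B [B0 BP]]] := syz ('I_(tgt s) -> R^o) _ (coef s).
  exists (existT _ k B); split=> [i j|b b0].
    have := congr1 (fun f : 'I_(tgt s) -> R^o => f j) (B0 i).
    by rewrite fct_sumE.
  by apply: BP; apply/funext => j; rewrite fct_sumE; exact: b0.
pose nxt s := projT1 (cid (nxt_ex s)); have nxtP s := projT2 (cid (nxt_ex s)).
have [k0 [B0 [B00 B0P]]] := syz _ _ e.
(* The target of the next matrix is by definition the source of the present one. *)
pose st := fix st (i : nat) : mat :=
  if i is j.+1 then existT _ (src (st j)) (nxt (st j)) else existT _ n0 (existT _ k0 B0).
unshelve eexists; last by [].
exact: (@FreeResolution C (fun i => tgt (st i)) (fun i => coef (st i)) e eP B00 B0P
  (fun i => (nxtP (st i)).1) (fun i => (nxtP (st i)).2)).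
Qed.

Variables (C : lmodType R) (X : free_resolution C).
Local Notation n := (rk X).

Lemma hom_of_gens N (v : 'I_(n 0) -> N) : (forall k, \sum_j bd X 0 k j *: v j = 0) ->
  exists h : {linear C -> N}, forall j, h (gen X j) = v j.
Proof.
move=> v0; pose P c y := exists b : 'I_(n 0) -> R,
  c = \sum_j b j *: gen X j /\ y = \sum_j b j *: v j.
have [|||h [_ hP]] := @linear_of_rel _ C N P.
- split; first by exists (fun=> 0); rewrite !big1 // => j _; rewrite scale0r.
  move=> a _ _ _ _ [b [-> ->]] [b' [-> ->]]; exists (fun j => a * b j + b' j).
  by split; rewrite scaler_sumr -big_split; apply: eq_bigr => j _; rewrite scalerDl scalerA.
- move=> y [b [/esym/gen_relations[c bE] ->]].
  under eq_bigr do rewrite bE scaler_suml.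
  rewrite exchange_big big1 // => k _ /=; under eq_bigr do rewrite -scalerA.
  by rewrite -scaler_sumr v0 scaler0.
- by move=> c; have [b ->] := gen_span X c; exists (\sum_j b j *: v j), b.
exists h => j; apply/esym/hP; exists (fun k => (k == j)%:R).
by rewrite !sum_delta.
Qed.

Lemma hom_gens_relation N (h : {linear C -> N}) k :
  \sum_j bd X 0 k j *: h (gen X j) = 0.
Proof.
under eq_bigr do rewrite -linearZZ.
by rewrite -linear_sum bd_gen linear0.
Qed.

Lemma hom_gens_eq N (h h' : {linear C -> N}) :
  (forall j, h (gen X j) = h' (gen X j)) -> forall c, h c = h' c.
Proof.
move=> hh c; have [b ->] := gen_span X c; rewrite !linear_sum.
by apply: eq_bigr => j _; rewrite !linearZZ hh.
Qed.

(** Ext^i(C, A) = 0 for all i > 0. The submodule A of N is given by a predicate so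
    that cycles and boundaries of a complex can be used without types of their
    own. *)
Definition Ext_vanish N (A : N -> Prop) := forall i (v : 'I_(n i.+1) -> N),
  (forall k, A (v k)) -> (forall l, \sum_k bd X i.+1 l k *: v k = 0) ->
  exists w : 'I_(n i) -> N, (forall j, A (w j)) /\ forall k, v k = \sum_j bd X i k j *: w j.

Fact transpose_bd_linear i :
  linear (fun (u : 'I_(n i.+1) -> R^o) j => \sum_k (u k : R) * bd X i k j : R^o).
Proof.
move=> a u u'; apply/funext => j.
rewrite -[RHS]/(a * (\sum_k (u k : R) * bd X i k j) + \sum_k (u' k : R) * bd X i k j).
rewrite mulr_sumr -big_split; apply: eq_bigr => k _ /=.
by rewrite mulrDl mulrA.
Qed.

Fact free_cplxK i (u : 'I_(n i.+2) -> R^o) :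
  mklin (@transpose_bd_linear i) (mklin (@transpose_bd_linear i.+1) u) = 0.
Proof.
apply/funext => j; rewrite !mklinE.
under eq_bigr do rewrite mulr_suml.
rewrite exchange_big big1 // => k _ /=; under eq_bigr do rewrite -mulrA.
by rewrite -mulr_sumr bd_bd mulr0.
Qed.
Definition free_cplx := @ChainComplex R (fun i => ('I_(n i) -> R^o)) _ free_cplxK.

Fact gen_comb_linear : linear (fun u : 'I_(n 0) -> R^o => \sum_j (u j : R) *: gen X j).
Proof.
move=> a u u'; rewrite scaler_sumr -big_split; apply: eq_bigr => j _ /=.
by rewrite scalerDl scalerA.
Qed.

Fact free_aug_bd (u : free_cplx 1%N) : mklin gen_comb_linear (boundary free_cplx 0 u) = 0.
Proof.
rewrite mklinE; under eq_bigr do rewrite scaler_suml.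
rewrite exchange_big big1 // => k _ /=; under eq_bigr do rewrite -scalerA.
by rewrite -scaler_sumr bd_gen scaler0.
Qed.
Definition free_augmented : augmented C := Augmented free_aug_bd.

Lemma tuple_projective m : projective ('I_m -> R^o).
Proof.
move=> A B p f ps.
have /choice[a aP] : forall j : 'I_m, exists a, p a = f (coord_inj R^o j 1) by move=> j; apply: ps.
have gl : linear (fun u : 'I_m -> R^o => \sum_j (u j : R) *: a j).
  move=> c u u'; rewrite scaler_sumr -big_split; apply: eq_bigr => j _ /=.
  by rewrite scalerDl scalerA.
exists (mklin gl) => u; rewrite mklinE linear_sum.
have uE : u = \sum_j (u j : R) *: coord_inj R^o j 1.
  apply/funext => k; rewrite fct_sumE -[LHS](@sum_delta R R^o _ u k).
  apply: eq_bigr => j _; rewrite -[RHS]/((u j : R) *: coord_inj R^o j 1 k) coord_injE eq_sym.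
  rewrite /GRing.scale /= mulrC; by case: eqP.
rewrite [in RHS]uE linear_sum; apply: eq_bigr => j _.
by rewrite !linearZZ aP.
Qed.

Lemma free_augmented_resolution : projective_resolution free_augmented.
Proof.
split=> [i|]; first exact: tuple_projective.
split=> [c|]; first by have [b ->] := gen_span X c; exists b.
case=> [|i] u u0.
  by have [c cP] := gen_relations u0; exists c; apply/funext => j; rewrite cP.
have [|c cP] := @bd_relations _ X i u; last by exists c; apply/funext => j; rewrite cP.
by move=> j; have := congr1 (fun f : 'I_(n i) -> R^o => f j) u0.
Qed.

Lemma Ext_vanish_semidualizing : (forall i, ExtS_eq0 i C C) -> Ext_vanish (fun _ : C => True).
Proof.
move=> H i v _ v0.
have fl : linear (fun u : 'I_(n i.+1) -> R^o => \sum_k (u k : R) *: v k).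
  move=> a u u'; rewrite scaler_sumr -big_split; apply: eq_bigr => j _ /=.
  by rewrite scalerDl scalerA.
have [u|g gP] := H i free_augmented free_augmented_resolution (mklin fl).
  rewrite mklinE; under eq_bigr do rewrite scaler_suml.
  rewrite exchange_big big1 // => l _ /=; under eq_bigr do rewrite -scalerA.
  by rewrite -scaler_sumr v0 scaler0.
exists (fun j => g (coord_inj R^o j 1)); split=> // k.
have := gP (coord_inj R^o k 1); rewrite mklinE.
under eq_bigr do rewrite coord_injE.
rewrite (_ : \sum_k0 _ = v k); last first.
  rewrite (bigD1 k) //= eqxx scale1r big1 ?addr0 // => j /negbTE->.
  by rewrite scale0r.
move=> ->; under [RHS]eq_bigr do rewrite -linearZZ.
rewrite -linear_sum; congr (g _); apply/funext => j.
rewrite fct_sumE -[LHS]/(\sum_l (coord_inj R^o k (1 : R^o) l : R) * bd X i l j).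
rewrite (bigD1 k) //= coord_injE eqxx mul1r big1 ?addr0; last first.
  by move=> l /negbTE; rewrite coord_injE => ->; rewrite mul0r.
rewrite (bigD1 j) //= big1 ?addr0.
  by rewrite -[RHS]/(bd X i k j *: coord_inj R^o j 1 j) coord_injE eqxx /GRing.scale /= mulr1.
move=> l /negbTE lj; rewrite -[LHS]/(bd X i k l *: coord_inj R^o l 1 j) coord_injE eq_sym lj.
exact: scaler0.
Qed.

Lemma flat_Ext_vanish F : flat F -> Ext_vanish (fun _ : C => True) ->
  Ext_vanish (fun _ : F ⊗ C => True).
Proof.
move=> Ff H i v _ v0.
have ex w : matmul C (bd X i.+1) w = 0 -> exists u, matmul C (bd X i) u = w.
  move=> w0; have [l|u [_ uw]] := H i w (fun=> I).
    exact: (congr1 (fun f : 'I_(n i.+2) -> C => f l) w0).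
  by exists u; apply/funext => k; rewrite uw.
have [|y yv] := flat_tuples Ff ex (v := v); first by apply/funext => l; exact: v0.
exists (fun j => tensor_map idfun (coord C j) y); split=> // k.
by rewrite yv tensor_map_coord.
Qed.

(** Surjectivity of F -> Hom(C, F ⊗ C): flatness keeps R -> C^(rk 0) -> C^(rk 1)
    exact, and its exactness says that all endomorphisms of C are scalar. *)
Lemma flat_hom F : flat F -> (forall h : {linear C -> C}, exists a : R, forall c, h c = a *: c) ->
  forall h : {linear C -> F ⊗ C}, exists f, forall c, h c = pure f c.
Proof.
move=> Ff H h.
have gl : linear (fun (r : R^o) (j : 'I_(n 0)) => (r : R) *: gen X j).
  by move=> a r s; apply/funext => j; rewrite scalerDl -scalerA.
have ex w : matmul C (bd X 0) w = 0 -> exists u, mklin gl u = w.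
  move=> w0; have [k|g gP] := @hom_of_gens _ w.
    exact: (congr1 (fun f : 'I_(n 1) -> C => f k) w0).
  by have [a aP] := H g; exists a; apply/funext => j; rewrite mklinE -gP aP.
have [|y yv] := flat_tuples Ff ex (v := fun j => h (gen X j)).
  by apply/funext => k; exact: hom_gens_relation.
have [f yE] : exists f, y = pure f (1 : R^o).
  elim/tensor_ind: y {yv} => [f r||x x' [f ->] [f' ->]].
  - by exists ((r : R) *: f); rewrite pureZl -pureZr; congr pure; rewrite /GRing.scale /= mulr1.
  - by exists 0; rewrite pure0l.
  - by exists (f + f'); rewrite pureDl.
exists f => c; apply: (@hom_gens_eq _ h (mklin (@pure_linear_r _ _ _ f))) => j.
by rewrite yv yE !tensor_mapE /= !mklinE scale1r.
Qed.

(** Injectivity of F -> Hom(C, F ⊗ C): flatness keeps R -> C^(rk 0) injective. *)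
Lemma flat_hom_inj F (f : F) : flat F -> (forall s : R, (forall c : C, s *: c = 0) -> s = 0) ->
  (forall c : C, pure f c = 0) -> f = 0.
Proof.
move=> Ff H f0.
have gl : linear (fun (r : R^o) (j : 'I_(n 0)) => (r : R) *: gen X j).
  by move=> a r s; apply/funext => j; rewrite scalerDl -scalerA.
have gi : injective (mklin gl).
  apply: linear_inj => r r0; apply: H => c; have [b ->] := gen_span X c.
  rewrite scaler_sumr big1 // => j _; rewrite scalerA mulrC -scalerA.
  by have := congr1 (fun g : 'I_(n 0) -> C => g j) r0; rewrite mklinE => ->; rewrite scaler0.
have f1 : pure f (1 : R^o) = 0.
  apply: (Ff _ _ _ gi); rewrite linear0 tensor_mapE.
  have -> : mklin gl (1 : R^o) = \sum_j coord_inj C j (gen X j).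
    apply/funext => k; rewrite fct_sumE mklinE scale1r.
    under eq_bigr do rewrite coord_injE eq_sym.
    by rewrite -big_mkcond big_pred1_eq.
  rewrite pure_sumr big1 // => j _.
  by rewrite -[f]/(idfun f) -tensor_mapE f0 linear0.
have ml : is_bilinear (fun (y : F) (r : R^o) => (r : R) *: y).
  split=> [r c y z|y c r s]; last by rewrite scalerDl -scalerA.
  by rewrite scalerDr !scalerA mulrC.
by have := congr1 (tensor_lift ml) f1; rewrite tensor_lift_pure scale1r linear0.
Qed.

End Resolution.
Arguments bd {R C} f i k j : rename.
Arguments gen {R C} f j : rename.

(** * Resolutions by modules of the class F_C *)

Section ExtSequences.
Variable R : comPzRingType.
Variables (C : lmodType R) (X : free_resolution C).
Implicit Types U V W : lmodType R.
Local Notation n := (rk X).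
Local Notation Ext_vanish := (Ext_vanish X).

Lemma Ext_vanish_eq U (A B : U -> Prop) : (forall u, A u <-> B u) -> Ext_vanish A -> Ext_vanish B.
Proof.
move=> AB HA i v vB v0; have [k|w [wA wv]] := HA i v _ v0; first exact/AB.
by exists w; split=> // j; exact/AB.
Qed.

Lemma Ext_vanish_zero U (A : U -> Prop) : A 0 -> (forall u, A u -> u = 0) -> Ext_vanish A.
Proof.
move=> A0 AP i v vA v0; exists (fun=> 0); split=> // k.
by rewrite (AP _ (vA k)) big1 // => j _; rewrite scaler0.
Qed.

Lemma Ext_vanish_iso U V (f : {linear U -> V}) (g : {linear V -> U}) : cancel g f ->
  Ext_vanish (fun _ : U => True) -> Ext_vanish (fun _ : V => True).
Proof.
move=> fg HU i v _ v0; have [l|w [_ wv]] := HU i (fun k => g (v k)) (fun=> I).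
  under eq_bigr do rewrite -linearZZ.
  by rewrite -linear_sum v0 linear0.
exists (fun j => f (w j)); split=> // k; rewrite -[LHS]fg wv linear_sum.
by apply: eq_bigr => j _; rewrite linearZZ.
Qed.

Lemma Ext_vanish_sub U (S : submodule U) (A : U -> Prop) : (forall u, A u -> S u) ->
  Ext_vanish A -> Ext_vanish (fun s : sub S => A (incl S s)).
Proof.
move=> AS HA i v vA v0; have [//|l|w [wA wv]] := HA i (fun k => incl S (v k)).
  under eq_bigr do rewrite -linearZZ.
  by rewrite -linear_sum v0 linear0.
exists (fun j => to_sub (AS _ (wA j))); split=> [j|k]; first exact: wA.
apply: (@incl_inj _ _ S); rewrite wv linear_sum.
by apply: eq_bigr => j _; rewrite linearZZ.
Qed.

(** Part of the long exact sequence of 0 -> ker f -> U -> im f -> 0. *)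
Lemma Ext_vanish_image U V (f : {linear U -> V}) : Ext_vanish (fun _ : U => True) ->
  Ext_vanish (fun u => f u = 0) -> Ext_vanish (fun v => exists u, f u = v).
Proof.
move=> HU HK i v /choice[u uv] v0.
have [l|l|w [wK wu]] := HK i.+1 (fun l => \sum_k bd X i.+1 l k *: u k).
- by rewrite linear_sum -[RHS](v0 l); apply: eq_bigr => k _; rewrite linearZZ uv.
- under eq_bigr do rewrite scaler_sumr.
  rewrite exchange_big big1 // => k _ /=; under eq_bigr do rewrite scalerA.
  by rewrite -scaler_suml bd_bd scale0r.
have [//|l|t [_ tP]] := HU i (fun k => u k - w k).
  by under eq_bigr do rewrite scalerBr; rewrite sumrB wu subrr.
exists (fun j => f (t j)); split=> [j|k]; first by exists (t j).
rewrite -uv -[u k](subrK (w k)) tP linearD /= wK addr0 linear_sum.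
by apply: eq_bigr => j _; rewrite linearZZ.
Qed.

(** Here Ext^1(C, ker p) = 0: lift the generators of C arbitrarily; the defects of
    the relations form a cocycle in ker p, and a primitive of it corrects the
    lifts. *)
Lemma hom_lift U V (p : {linear U -> V}) (h : {linear C -> V}) :
  Ext_vanish (fun u => p u = 0) -> (forall c, exists u, p u = h c) ->
  exists g : {linear C -> U}, forall c, h c = p (g c).
Proof.
move=> HK hp; have /choice[u uP] : forall j, exists u, p u = h (gen X j) by move=> j.
have [k|l|w [wK wP]] := HK 0%N (fun k => \sum_j bd X 0 k j *: u j).
- rewrite linear_sum -[RHS](hom_gens_relation h k).
  by apply: eq_bigr => j _; rewrite linearZZ uP.
- under eq_bigr do rewrite scaler_sumr.
  rewrite exchange_big big1 // => k _ /=; under eq_bigr do rewrite scalerA.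
  by rewrite -scaler_suml bd_bd scale0r.
have [k|g gP] := @hom_of_gens _ _ X _ (fun j => u j - w j).
  by under eq_bigr do rewrite scalerBr; rewrite sumrB wP subrr.
exists g; apply: (hom_gens_eq (X := X) (h' := p \o g)) => j.
by rewrite /= gP linearB /= wK subr0 uP.
Qed.

Hypothesis C_hom_eq0 : forall W, (forall (h : {linear C -> W}) c, h c = 0) -> zero_module W.

(** Every map C -> W / B lifts to W, hence is 0, so W / B = 0. *)
Lemma hom_detects W (B : submodule W) : Ext_vanish B ->
  (forall (h : {linear C -> W}) c, B (h c)) -> forall w, B w.
Proof.
move=> HB hB w; apply/pr_eq0; apply: C_hom_eq0 => h c.
have [|c'|g ->] := @hom_lift _ _ (pr B) h.
- by apply: Ext_vanish_eq HB => u; split=> /pr_eq0.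
- exact: pr_surj.
- by apply/pr_eq0/hB.
Qed.

Section BoundedComplex.
Variables (Z : chain_complex R) (N : nat).
Hypothesis ZExt : forall i, Ext_vanish (fun _ : Z i.+1 => True).
Hypothesis Z0 : forall i, (N < i)%N -> zero_module (Z i).

Definition exact_at i := forall y : Z i.+1, boundary Z i y = 0 -> exists x, boundary Z i.+1 x = y.
Definition hom_exact_at i := forall h : {linear C -> Z i.+1}, (forall c, boundary Z i (h c) = 0) ->
  exists g : {linear C -> Z i.+2}, forall c, h c = boundary Z i.+1 (g c).

Lemma Ext_vanish_boundaries_step i : exact_at i -> Ext_vanish (im (boundary Z i.+1)) ->
  Ext_vanish (im (boundary Z i)).
Proof.
move=> ei HI; apply: Ext_vanish_image => //; apply: Ext_vanish_eq HI => y.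
by split=> [[x <-]|/ei//]; rewrite boundaryK.
Qed.

Lemma Ext_vanish_boundaries_top i : (N < i)%N -> Ext_vanish (im (boundary Z i)).
Proof. by move=> /Z0 z; apply: Ext_vanish_zero => [|u _]; [exact: submod0 | exact: z]. Qed.

(** Induction from the left end of the complex, where the boundaries are 0. *)
Lemma exact_boundaries j0 : (forall i, (j0 <= i)%N -> exact_at i) ->
  forall i, (j0 <= i)%N -> Ext_vanish (im (boundary Z i)).
Proof.
(* m bounds the distance to the zero part of the complex. *)
move=> Ze i; have [m] : exists m, (N < i + m)%N by exists N.+1; rewrite addnS ltnS leq_addl.
elim: m i => [|m IHm] i Nim ji; first by apply: Ext_vanish_boundaries_top; rewrite addn0 in Nim.
apply: Ext_vanish_boundaries_step; first exact: Ze.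
by apply: IHm; [rewrite addSnnS | exact: leqW].
Qed.

Lemma exact_hom_lift j0 (Ze : forall i, (j0 <= i)%N -> exact_at i) i (h : {linear C -> Z i}) :
  (j0 <= i)%N -> (forall c, exists x, boundary Z i x = h c) ->
  exists g : {linear C -> Z i.+1}, forall c, h c = boundary Z i (g c).
Proof.
move=> ji; apply: hom_lift; apply: Ext_vanish_eq (exact_boundaries Ze (leqW ji)) => y.
by split=> [[x <-]|/(Ze _ ji)//]; rewrite boundaryK.
Qed.

(** Induction from the left end. If Ext vanishes on the boundaries in Z_(i+1),
    [hom_detects] applies to them as a submodule of the cycles: a map from C to the
    cycles comes from Z_(i+2) by exactness of Hom(C, Z), so it lands in the
    boundaries. Exactness at Z_(i+1) then gives the vanishing of Ext on the
    boundaries in Z_i. *)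
Lemma exact_of_hom_exact j0 : (forall i, (j0 <= i)%N -> hom_exact_at i) ->
  forall i, (j0 <= i)%N -> exact_at i.
Proof.
move=> Zh i ji; suff [] : Ext_vanish (im (boundary Z i)) /\ exact_at i by [].
have [m] : exists m, (N < i + m)%N by exists N.+1; rewrite addnS ltnS leq_addl.
elim: m i ji => [|m IHm] i ji Nim.
  rewrite addn0 in Nim; split; first exact: Ext_vanish_boundaries_top.
  by move=> y _; exists 0; rewrite linear0 (Z0 (leqW Nim) y).
have [HI ei] : Ext_vanish (im (boundary Z i.+1)) /\ exact_at i.+1.
  by apply: IHm; [exact: leqW | rewrite addSnnS].
suff {}ei' : exact_at i by split=> //; exact: Ext_vanish_boundaries_step.
move=> y y0.
have BP : submodule_set (fun s : sub (ker (boundary Z i)) => im (boundary Z i.+1) (incl _ s)).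
  split; first by rewrite linear0; apply: submod0.
  by move=> a s t As At; rewrite linearP; apply: submodP.
apply: (@hom_detects _ (Submodule BP) _ _ (to_sub (y0 : ker (boundary Z i) y))).
  apply: Ext_vanish_sub HI => u [x <-]; exact: boundaryK.
move=> h c /=; have [c'|g gP] := Zh i ji (incl _ \o h); first exact: (subP (h c')).
by exists (g c); rewrite -gP.
Qed.

Lemma exact_of_hom_exact_all : (forall i, hom_exact_at i) ->
  (forall h : {linear C -> Z 0%N}, exists g : {linear C -> Z 1%N},
     forall c, h c = boundary Z 0 (g c)) ->
  is_exact Z.
Proof.
move=> Zh h0; have Ze := exact_of_hom_exact (j0 := 0%N) (fun i _ => Zh i).
split=> [y|i y]; last exact: Ze.
apply: (@hom_detects _ (im (boundary Z 0))); first exact: (exact_boundaries Ze).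
by move=> h c; have [g gP] := h0 h; exists (g c); rewrite -gP.
Qed.

End BoundedComplex.
End ExtSequences.

Section Adjunction.
Variable R : comPzRingType.
Implicit Types C F G M N U V W : lmodType R.

Section Curry.
Variables (F C N : lmodType R).

Fact curry_linear2 (f : {linear F ⊗ C -> N}) x : linear (fun c : C => f (pure x c)).
Proof. by move=> a c d; rewrite pureDr pureZr linearP. Qed.
Fact curry_linear (f : {linear F ⊗ C -> N}) : linear (fun x : F => mklin (curry_linear2 f x)).
Proof. by move=> a x y; apply: homP => c; rewrite mklinE pureP linearP. Qed.
Definition curry f : {linear F -> {linear C -> N}} := mklin (curry_linear f).
Lemma curryE f x c : curry f x c = f (pure x c). Proof. by []. Qed.

Fact uncurry_bilinear (g : {linear F -> {linear C -> N}}) : is_bilinear (fun x c => g x c).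
Proof. by split=> [c a x y|x a c d]; rewrite linearP. Qed.
Definition uncurry g : {linear F ⊗ C -> N} := tensor_lift (uncurry_bilinear g).
Lemma uncurryE g x c : uncurry g (pure x c) = g x c.
Proof. exact: tensor_lift_pure. Qed.
End Curry.

Lemma bijective_inverse U V (f : {linear U -> V}) : bijective f ->
  exists g : {linear V -> U}, cancel f g /\ cancel g f.
Proof.
move=> [g0 fg gf]; have [||g gP] := @inj_factor _ V _ _ f idfun.
- exact: can_inj fg.
- by move=> v; exists (g0 v); rewrite gf.
by exists g; split=> // x; apply: (can_inj fg); rewrite gP.
Qed.

Lemma swap_map (U U' V V' : lmodType R) (f : {linear U -> U'}) (g : {linear V -> V'}) x :
  swap _ _ (tensor_map f g x) =
  tensor_map g f (swap _ _ x).
Proof.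
apply: (tensor_eq (f := swap _ _ \o tensor_map f g) (g := tensor_map g f \o swap _ _)) => u v.
rewrite -[LHS]/(swap _ _ (tensor_map f g (pure u v))).
by rewrite -[RHS]/(tensor_map g f (swap _ _ (pure u v))) tensor_mapE !swapE tensor_mapE.
Qed.

Lemma tensor_right_exact_l C U V W (f : {linear U -> V}) (g : {linear V -> W}) :
  (forall w, exists v, g v = w) -> (forall v, g v = 0 -> exists u, f u = v) ->
  forall x : V ⊗ C, tensor_map g idfun x = 0 -> exists y : U ⊗ C, tensor_map f idfun y = x.
Proof.
move=> gs fg x gx; have [|y yx] := tensor_right_exact (F := C) gs fg (x := swap _ _ x).
  by rewrite -swap_map gx linear0.
exists (swap _ _ y); apply: (can_inj (@swapK _ _ _)).
by rewrite swap_map swapK.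
Qed.

Lemma tensor_surj C V W (g : {linear V -> W}) : (forall w, exists v, g v = w) ->
  forall y : W ⊗ C, exists x : V ⊗ C, tensor_map g idfun x = y.
Proof.
move=> gs; apply: tensor_ind => [w c||y y' [x <-] [x' <-]].
- by have [v <-] := gs w; exists (pure v c); rewrite tensor_mapE.
- by exists 0; rewrite linear0.
- by exists (x + x'); rewrite linearD.
Qed.

Lemma tensor_map_comp_l C U V W (f : {linear U -> V}) (g : {linear V -> W}) (x : U ⊗ C) :
  tensor_map g idfun (tensor_map f idfun x) = tensor_map (g \o f) idfun x.
Proof.
apply: (tensor_eq (f := tensor_map g idfun \o tensor_map f idfun) (g := tensor_map (g \o f) idfun)).
by move=> u c; rewrite -[LHS]/(tensor_map g idfun (tensor_map f idfun (pure u c))) !tensor_mapE.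
Qed.

Lemma tensor_map_eq0_l C U V (f : {linear U -> V}) (x : U ⊗ C) : (forall u, f u = 0) ->
  tensor_map f idfun x = 0.
Proof.
move=> f0; apply: (tensor_eq (f := tensor_map f idfun) (g := \0)) => u c.
by rewrite tensor_mapE f0 pure0l.
Qed.

Section HomAugmented.
Variables (C M : lmodType R) (X : augmented M).
Fact hom_aug_boundary (f : hom_complex C X 1%N) :
  hom_post C (aug X) (boundary (hom_complex C X) 0 f) = 0.
Proof. by apply: homP => c; exact: aug_boundary. Qed.
Definition hom_augmented : augmented {linear C -> M} := Augmented hom_aug_boundary.
End HomAugmented.

Section TensorAugmented.
Variables (C M : lmodType R) (X : augmented M).
Fact tensor_boundaryK i (x : X i.+2 ⊗ C) :
  tensor_map (boundary X i) idfun (tensor_map (boundary X i.+1) idfun x) = 0.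
Proof. by rewrite tensor_map_comp_l; apply: tensor_map_eq0_l => u; exact: boundaryK. Qed.
Definition tensor_complex := @ChainComplex R (fun i => (X i ⊗ C)%type) _ tensor_boundaryK.
Fact tensor_aug_boundary (x : tensor_complex 1%N) :
  tensor_map (aug X) idfun (boundary tensor_complex 0 x) = 0.
Proof. by rewrite tensor_map_comp_l; apply: tensor_map_eq0_l => u; exact: aug_boundary. Qed.
Definition tensor_augmented : augmented (M ⊗ C)%type := Augmented tensor_aug_boundary.
End TensorAugmented.

Section Post.
Variables (M N : lmodType R) (X : augmented M) (f : {linear M -> N}).
Fact post_aug_boundary (x : X 1%N) : (f \o aug X) (boundary X 0 x) = 0.
Proof. by rewrite /= aug_boundary linear0. Qed.
Definition post_augmented : augmented N := Augmented post_aug_boundary.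
End Post.

(** Compose augmentations with the isomorphism. *)
Lemma proper_dim_iso K M N : isomorphic M N -> proper_dim K M = proper_dim K N.
Proof.
have imp (M' N' : lmodType R) (f : {linear M' -> N'}) (g : {linear N' -> M'}) (X : augmented M') :
    cancel f g -> cancel g f -> proper_resolution K X -> proper_resolution K (post_augmented X f).
  move=> fg gf [XK XP]; split=> // Y /XP/hom_exactP[e0 e1]; apply/hom_exactP; split.
    move=> h; have [k kP] := e0 (g \o h); exists k => y.
    by rewrite /= -[LHS]gf (_ : g (h y) = aug X (k y)) -?kP.
  case=> [|i] h hd; last exact: (e1 i.+1 h).
  by apply: (e1 0%N h) => y; apply: (can_inj fg); rewrite linear0; exact: hd.
move=> [f /bijective_inverse[g [fg gf]]].
rewrite /proper_dim; congr (infimum _ _); apply/seteqP; split=> d [X XP ->].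
  by exists (post_augmented X f) => //; exact: imp XP.
by exists (post_augmented X g) => //; exact: imp XP.
Qed.

Lemma complex_length_eq (X Y : chain_complex R) :
  (forall i, zero_module (X i) <-> zero_module (Y i)) -> complex_length X = complex_length Y.
Proof.
move=> XY; rewrite /complex_length; congr (supremum _ _); congr (image _ _).
by apply/seteqP; split=> i /= nz /XY.
Qed.

End Adjunction.

Section Semidualizing.
Variables (R : comPzRingType) (C : lmodType R).
Hypothesis hR : noetherian R.
Hypothesis hC : semidualizing C.
Implicit Types F G M N : lmodType R.

Lemma sd_hom (h : {linear C -> C}) : exists a : R, forall c, h c = a *: c.
Proof.
have [_ [g _ gK] _] := hC; exists (g h) => c.
by rewrite -{1}(gK h).
Qed.

Lemma sd_faithful (s : R) : (forall c : C, s *: c = 0) -> s = 0.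
Proof.
have [_ [g hK _] _] := hC => s0; apply: (can_inj hK); apply: homP => c.
by rewrite /= s0 scale0r.
Qed.

Lemma sd_hom_eq0 M : (forall (h : {linear C -> M}) c, h c = 0) -> zero_module M.
Proof. by case: hC => Cfg _ _; apply: hom_eq0 => //; exact: sd_faithful. Qed.

Lemma sd_resolution : exists X : free_resolution C, True.
Proof. by case: hC => Cfg _ _; exact: free_resolution_exists. Qed.

Lemma sd_flat_hom F (h : {linear C -> F ⊗ C}) : flat F -> exists f, forall c, h c = pure f c.
Proof. by move=> Ff; have [X _] := sd_resolution; apply: (flat_hom X Ff sd_hom). Qed.

Lemma sd_pure_inj F (f : F) : flat F -> (forall c : C, pure f c = 0) -> f = 0.
Proof. by move=> Ff; have [X _] := sd_resolution; apply: (flat_hom_inj X Ff sd_faithful). Qed.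

Lemma sd_Ext (X : free_resolution C) M : FC C M -> Ext_vanish X (fun _ : M => True).
Proof.
have [_ _ HE] := hC => -[F Ff [f /bijective_inverse[g [fg gf]]]].
apply: (Ext_vanish_iso fg).
exact/flat_Ext_vanish/Ext_vanish_semidualizing.
Qed.

(** The functor - ⊗ C is full on flat modules, because G = Hom(C, G ⊗ C). *)
Lemma sd_flat_full F G (f : {linear F ⊗ C -> G ⊗ C}) : flat G ->
  exists g : {linear F -> G}, forall x c, f (pure x c) = pure (g x) c.
Proof.
move=> Gf; pose P x y := forall c, f (pure x c) = pure y c.
have [|||g [gP _]] := @linear_of_rel _ F G P.
- split=> [c|a x x' y y' e e' c]; first by rewrite !pure0l linear0.
  by rewrite !pureP linearP e e'.
- by move=> y e; apply: sd_pure_inj => // c; rewrite -e pure0l linear0.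
- by move=> x; have [y yP] := sd_flat_hom (curry f x) Gf; exists y => c; rewrite -yP.
by exists g.
Qed.

Lemma FC_self : FC C C.
Proof.
exists (R^o : lmodType R); first exact/projective_flat/projective_regular.
have bl : is_bilinear (fun (r : R^o) (c : C) => (r : R) *: c).
  split=> [c a r s|r a c d]; first by rewrite scalerDl -scalerA.
  by rewrite scalerDr !scalerA mulrC.
exists (mklin (@pure_linear_r R R^o C 1)); exists (tensor_lift bl) => [c|x].
  by rewrite mklinE tensor_lift_pure scale1r.
elim/tensor_ind: x => [r c||x y ex ey].
- rewrite tensor_lift_pure mklinE pureZr -pureZl.
  by congr pure; rewrite /GRing.scale /= mulr1.
- by rewrite !linear0.
- by rewrite !linearD ex ey.
Qed.

Lemma hom_flat M : FC C M -> flat {linear C -> M}.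
Proof.
move=> [F Ff [f /bijective_inverse[g [fg gf]]]].
pose p : {linear F -> {linear C -> M}} := hom_post C g \o curry idfun.
have pE x c : p x c = g (pure x c) by [].
have pinj : injective p.
  apply: linear_inj => x px; apply: sd_pure_inj => // c.
  by apply: (can_inj gf); rewrite -pE px linear0.
have [//|h|k kP] := @inj_factor _ _ _ _ p idfun.
  have [x xP] := sd_flat_hom (f \o h) Ff; exists x; apply: homP => c.
  by rewrite pE -xP /= fg.
exact: flat_retract kP Ff.
Qed.

Lemma FC_zero M : zero_module M -> FC C M.
Proof.
move=> z; exists M; first exact: zero_flat.
have zt : zero_module (M ⊗ C) by apply: tensor_zero_module => m c; rewrite (z m) pure0l.
by exists \0; exists (fun=> 0) => x; [rewrite (z x) | rewrite (zt x)].
Qed.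

Lemma hom_augmented_exact Y M (X : augmented M) :
  is_exact (hom_complex Y (hom_complex C (aug_complex X))) ->
  is_exact (hom_complex Y (aug_complex (hom_augmented C X))).
Proof.
move=> /hom_exactP[e0 e1]; apply/hom_exactP; split=> [f|[|i] f fd]; first exact: (e0 f).
  exact: (e1 0%N f fd).
exact: (e1 i.+1 f fd).
Qed.

Lemma hom_hom_exact Y (Z : chain_complex R) : is_exact (hom_complex (Y ⊗ C)%type Z) ->
  is_exact (hom_complex Y (hom_complex C Z)).
Proof.
move=> /hom_exactP[e0 e1]; apply/hom_exactP; split=> [f|i f fd].
  have [g gP] := e0 (uncurry f); exists (curry g) => y; apply: homP => c.
  by rewrite -uncurryE gP.
have [|g gP] := e1 i (uncurry f).
  apply: (tensor_eq (f := boundary Z i \o uncurry f) (g := \0)) => y c.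
  rewrite /= uncurryE; exact: (congr1 (fun h : {linear C -> Z i} => h c) (fd y)).
exists (curry g) => y; apply: homP => c.
by rewrite -uncurryE gP.
Qed.

Lemma FC_tensor F : flat F -> FC C (F ⊗ C)%type.
Proof. by move=> Ff; exists F => //; exists idfun; exists id. Qed.

Lemma hom_proper M (X : augmented M) : proper_resolution (FC C) X ->
  proper_resolution (@flat R) (hom_augmented C X).
Proof.
move=> [XF XP]; split=> [i|Y Yf]; first exact/hom_flat/XF.
exact/hom_augmented_exact/hom_hom_exact/XP/FC_tensor.
Qed.

Definition tensor_hom_augmented M (G : augmented {linear C -> M}) : augmented M :=
  post_augmented (tensor_augmented C G) (uncurry idfun).

(** Maps F ⊗ C -> G_i ⊗ C come from maps F -> G_i, and maps F ⊗ C -> M are maps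
    F -> Hom(C, M), so lifting problems for the new complex are lifting problems
    for G. *)
Lemma tensor_hom_proper M (G : augmented {linear C -> M}) : proper_resolution (@flat R) G ->
  proper_resolution (FC C) (tensor_hom_augmented G).
Proof.
move=> [Gf GP]; split=> [i|Y [F Ff [f /bijective_inverse[g [fg gf]]]]]; first exact/FC_tensor/Gf.
have /hom_exactP[e0 e1] := GP F Ff; apply/hom_exactP.
have transfer i (h : {linear Y -> G i ⊗ C}) :
    exists k : {linear F -> G i}, forall y, h y = tensor_map k idfun (f y).
  have [k kP] := sd_flat_full (h \o g) (Gf i); exists k => y; rewrite -{1}(fg y).
  apply: (tensor_eq (f := h \o g) (g := tensor_map k idfun)) => x c.
  by rewrite kP tensor_mapE.
split=> [h|[|i] h hd].
- have [k kP] := e0 (curry (h \o g)).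
  exists (tensor_map k idfun \o f) => y; rewrite -{1}(fg y).
  apply: (tensor_eq (f := h \o g)
    (g := uncurry idfun \o tensor_map (aug G) idfun \o tensor_map k idfun)) => x c.
  rewrite -[RHS]/(uncurry idfun (tensor_map (aug G) idfun (tensor_map k idfun (pure x c)))).
  rewrite !tensor_mapE uncurryE.
  exact: (congr1 (fun l : {linear C -> M} => l c) (kP x)).
- have [k kP] := transfer 0%N h; have [x|l lP] := e1 0%N k.
    apply: homP => c; have := hd (g (pure x c)).
    rewrite kP gf tensor_mapE -[LHS]/(uncurry idfun (tensor_map (aug G) idfun (pure (k x) c))).
    by rewrite tensor_mapE uncurryE.
  exists (tensor_map l idfun \o f) => y; rewrite kP [RHS]/= tensor_map_comp_l.
  apply: (tensor_eq (f := tensor_map k idfun) (g := tensor_map (boundary G 0 \o l) idfun)) => x c.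
  by rewrite !tensor_mapE [k x]lP.
- have [k kP] := transfer i.+1 h; have [x|l lP] := e1 i.+1 k.
    apply: sd_pure_inj => [|c]; first exact: Gf.
    have := hd (g (pure x c)).
    rewrite kP gf tensor_mapE -[LHS]/(tensor_map (boundary G i) idfun (pure (k x) c)).
    by rewrite tensor_mapE.
  exists (tensor_map l idfun \o f) => y; rewrite kP [RHS]/= tensor_map_comp_l.
  apply: (tensor_eq (f := tensor_map k idfun)
    (g := tensor_map (boundary G i.+1 \o l) idfun)) => x c.
  by rewrite !tensor_mapE [k x]lP.
Qed.

Lemma FC_dim_hom M : proper_dim (FC C) M = flat_dim {linear C -> M}.
Proof.
rewrite /flat_dim /proper_dim; congr (infimum _ _); apply/seteqP; split=> d [X XP ->].
  exists (hom_augmented C X); first exact: hom_proper.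
  apply: complex_length_eq => i; split=> [z f|z]; first by apply: homP => c; rewrite [LHS]z.
  by apply: sd_hom_eq0 => h c; rewrite (z h).
exists (tensor_hom_augmented X); first exact: tensor_hom_proper.
apply: complex_length_eq => i; split=> [z|z u].
  by apply: tensor_zero_module => x c; rewrite (z x) pure0l.
by apply: sd_pure_inj => [|c]; [exact: XP.1 | rewrite [LHS]z].
Qed.

Lemma aug_complex_bounded n M (X : augmented M) : (forall i, (n < i)%N -> zero_module (X i)) ->
  forall i, (n.+1 < i)%N -> zero_module (aug_complex X i).
Proof. by move=> X0 [|i]//; exact: X0. Qed.

Lemma FC_proper_exact n M (X : augmented M) : proper_resolution (FC C) X ->
  (forall i, (n < i)%N -> zero_module (X i)) -> is_exact (aug_complex X).
Proof.
move=> [XF XP] X0; have [P _] := sd_resolution.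
have /hom_exactP[e0 e1] := XP C FC_self.
apply: (@exact_of_hom_exact_all _ _ P sd_hom_eq0 (aug_complex X) n.+1) => //.
- by move=> i; apply: sd_Ext; exact: XF.
- exact: aug_complex_bounded.
Qed.

Lemma FC_exact_hom n M (L : augmented M) : exact_resolution (FC C) n L ->
  exact_resolution (@flat R) n (hom_augmented C L).
Proof.
move=> [LF L0 Le].
have LF' i : FC C (L i) by case: (leqP i n) => [/LF//|/L0/FC_zero].
split=> [i _|i /L0 z f|]; first exact: hom_flat.
  by apply: homP => c; rewrite [LHS]z.
have [P _] := sd_resolution; have [e0 e1] := Le.
have lift i (h : {linear C -> aug_complex L i}) :
    (forall c, exists x, boundary (aug_complex L) i x = h c) ->
    exists g : {linear C -> aug_complex L i.+1}, forall c, h c = boundary (aug_complex L) i (g c).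
  apply: (@exact_hom_lift _ _ P (aug_complex L) n.+1 _ _ 0%N (fun i _ => e1 i)) => //.
  - by move=> j; apply: sd_Ext; exact: LF'.
  - exact: aug_complex_bounded.
have [h0 h1] : is_exact (hom_complex C (aug_complex L)).
  split=> [h|i h hd].
    by have [c|g gP] := lift 0%N h; [exact: e0 | exists g; apply: homP => c; rewrite gP].
  have [c|g gP] := lift i.+1 h; last by exists g; apply: homP => c; rewrite gP.
  by apply: e1; exact: (congr1 (fun k : {linear C -> aug_complex L i} => k c) hd).
split=> [h|[|i] h hd]; first exact: (h0 h).
  exact: (h1 0%N h hd).
exact: (h1 i.+1 h hd).
Qed.

Lemma FC_dim_le M n : (proper_dim (FC C) M <= (n%:Z)%:E)%E <->
  exists L : augmented M, exact_resolution (FC C) n L.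
Proof.
split=> [/proper_dim_le[X XP X0]|[L /FC_exact_hom LF]].
  exists X; split=> // [i _|]; first exact: XP.1.
  exact: FC_proper_exact XP X0.
rewrite FC_dim_hom; apply/proper_dim_le.
exact: proper_flat_of_exact hR LF.
Qed.

Definition eta M : {linear M -> {linear C -> M ⊗ C}} := curry idfun.
Lemma etaE M (m : M) c : eta M m c = pure m c. Proof. by []. Qed.

(** For a bounded proper flat resolution G of M, Hom(C, -) of G ⊗ C is exact in
    positive degrees because it is G there; so G ⊗ C is exact there, and everywhere
    by right exactness of the tensor product. Then Hom(C, -) keeps it exact, which
    makes both M and Hom(C, M ⊗ C) the cokernel of G_1 -> G_0. *)
Lemma eta_bijective_of_flat_dim M n : (flat_dim M <= (n%:Z)%:E)%E -> bijective (eta M).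
Proof.
move=> /proper_dim_le[G GP G0]; have [g0 g1] := flat_proper_exact GP; have Gf := GP.1.
(* Degrees are shifted by one: Z_0 is M ⊗ C and Z_(i+1) is G_i ⊗ C. *)
have [P _] := sd_resolution; pose Z := aug_complex (tensor_augmented C G).
have ZE i : Ext_vanish P (fun _ : Z i.+1 => True) by apply: sd_Ext; exact: FC_tensor.
have Z0 : forall i, (n.+1 < i)%N -> zero_module (Z i).
  apply: aug_complex_bounded => i /G0 z.
  by apply: tensor_zero_module => x c; rewrite (z x) pure0l.
have Ze i : (1 <= i)%N -> exact_at Z i.
  apply: (exact_of_hom_exact sd_hom_eq0 ZE Z0) => -[//|j] _ h hd.
  have [x xP] := sd_flat_hom h (Gf j.+1).
  have [|y yx] := g1 j.+1 x.
    apply: sd_pure_inj => [|c]; first exact: Gf.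
    have := hd c; rewrite xP; apply: etrans; exact/esym/tensor_mapE.
  exists (curry idfun y) => c; rewrite xP curryE -yx; exact/esym/tensor_mapE.
have Ze0 : exact_at Z 0.
  by apply: tensor_right_exact_l => [m|x /(g1 0%N x)]; first exact: g0.
have ZX i : exact_at Z i by case: i => [|i]; [exact: Ze0 | exact: Ze].
have lift i (h : {linear C -> Z i}) := 
  @exact_hom_lift _ _ P Z n.+1 ZE Z0 0%N (fun j _ => ZX j) i h isT.
have inj : injective (eta M).
  apply: linear_inj => m m0; have [x xm] := g0 m.
  have [c|k kP] := lift 1%N (eta _ x).
    apply: Ze0; transitivity (pure m c); last by rewrite -etaE m0.
    by rewrite -xm; exact: tensor_mapE.
  have [y yP] := sd_flat_hom k (Gf 1%N).
  have xy : x = boundary G 0 y.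
    apply/eqP; rewrite -subr_eq0; apply/eqP; apply: sd_pure_inj => [|c]; first exact: Gf.
    rewrite pureDl -scaleN1r pureZl scaleN1r [pure x c](kP c) yP.
    by rewrite [X in X - _]tensor_mapE subrr.
  by rewrite -xm xy; exact: aug_boundary.
have surj h : exists m, eta M m = h.
  have [c|k kP] := lift 0%N h; first by apply: tensor_surj; exact: g0.
  have [y yP] := sd_flat_hom k (Gf 0%N).
  exists (aug G y); apply: homP => c; rewrite kP yP; exact/esym/tensor_mapE.
have [h|g gP] := @inj_factor _ _ _ _ (eta M) idfun inj; first by have [m] := surj h; exists m.
by exists g => // m; apply: inj; rewrite gP.
Qed.

(** Put N = Hom(C, M ⊗ C), with a bounded proper flat resolution G. Then G ⊗ C is
    an exact resolution of M ⊗ C, so the evaluation N ⊗ C -> M ⊗ C is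
    injective; being inverse to it on one side, M ⊗ C -> N ⊗ C is onto, the
    cokernel of eta is killed by - ⊗ C, and eta is surjective. Let K be its
    kernel. Since G ⊗ C is exact, Tor_1(N, C) = 0, so K ⊗ C embeds in M ⊗ C; it
    is sent to 0 there, so K ⊗ C = 0 and K = 0. The argument about Tor_1 is made
    on the pullback S of M and G_0 over N, in which K has the flat cokernel G_0. *)
Lemma eta_bijective_of_FC_dim M n : (proper_dim (FC C) (M ⊗ C)%type <= (n%:Z)%:E)%E ->
  bijective (eta M).
Proof.
rewrite FC_dim_hom => /proper_dim_le[G GP G0].
have [g0 g1] := flat_proper_exact GP; have Gf := GP.1.
pose X := tensor_hom_augmented G; pose N : lmodType R := {linear C -> M ⊗ C}.
have X0 i : (n < i)%N -> zero_module (X i).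
  by move=> /G0 z; apply: tensor_zero_module => x c; rewrite (z x) pure0l.
have [x0 x1] := FC_proper_exact (tensor_hom_proper GP) X0.
pose ev : {linear N ⊗ C -> M ⊗ C} := uncurry idfun.
have ev_inj : injective ev.
  apply: linear_inj => y y0; have [x xy] := tensor_surj (C := C) g0 y.
  have [|x' x'x] := x1 0%N x; first by rewrite -[RHS]y0 -xy.
  rewrite -xy -x'x; exact: (aug_boundary (a := tensor_augmented C G)).
have surj h : exists m, eta M m = h.
  apply/(pr_eq0 (im (eta M))); apply: (tensor_eq0 hR) sd_faithful _ _ _; first by case: hC.
  move=> c q; have [nu <-] := pr_surj q.
  (* Write nu c as a sum of tensors m_i ⊗ c_i; both sides evaluate to it. *)
  have e : pure nu c = \sum_(p <- repr (nu c)) pure (eta M p.1) p.2 :> N ⊗ C.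
    apply: ev_inj; rewrite uncurryE linear_sum [LHS]pure_span.
    by apply: eq_bigr => p _; rewrite uncurryE.
  pose T : {linear N ⊗ C -> C ⊗ quo (im (eta M))} := tensor_map idfun (pr (im (eta M))) \o swap _ _.
  have TE f d : T (pure f d) = pure d (pr (im (eta M)) f).
    by rewrite -[LHS]/(tensor_map _ _ (swap _ _ (pure f d))) swapE tensor_mapE.
  rewrite -TE e linear_sum big1 // => p _.
  rewrite TE (_ : pr _ _ = 0) ?pure0r //; apply/pr_eq0.
  by exists p.1.
have inj : injective (eta M).
  apply: linear_inj => m m0; pose K := ker (eta M).
  pose D : {linear (M * G 0%N)%type -> N} := (eta M \o fst) \- (aug G \o snd).
  pose S := ker D.
  have SP (s : sub S) : eta M (incl S s).1 = aug G (incl S s).2.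
    by have /eqP := subP s; rewrite subr_eq0 => /eqP.
  have mkS m' g : eta M m' = aug G g -> S (m', g) by move=> e; rewrite /S /= e subrr.
  have [||i iP] := @inj_factor _ _ _ _ (incl S) (pairl (incl K) \0); first exact: incl_inj.
    move=> k; suff h : S (pairl (incl K) \0 k) by exists (to_sub h).
    by apply: mkS; rewrite linear0; exact: (subP k).
  (* The kernel of S -> M is the kernel of G_0 -> N, that is, the image of G_1. *)
  have [||b bP] := @inj_factor _ _ _ _ (incl S) (pairl \0 (boundary G 0)); first exact: incl_inj.
    move=> g; suff h : S (pairl \0 (boundary G 0) g) by exists (to_sub h).
    by apply: mkS; rewrite linear0 aug_boundary.
  have iS : ses i (snd \o incl S : {linear sub S -> G 0%N}).
    split.
    - apply: linear_inj => k ik; apply: (@incl_inj _ _ K).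
      have e : (incl S (i k)).1 = incl K k := congr1 fst (iP k).
      by rewrite -e ik !linear0.
    - move=> g; have [m' m'P] := surj (aug G g).
      by exists (to_sub (mkS _ _ m'P)).
    - move=> s; split=> [s0|[k <-]]; last exact: (congr1 snd (iP k)).
      have {}s0 : (incl S s).2 = 0 := s0.
      have Ks : K (incl S s).1 by rewrite /K /= SP s0 linear0.
      exists (to_sub Ks); apply: (@incl_inj _ _ S); rewrite iP pairlE.
      by rewrite [RHS]surjective_pairing s0.
  have Kzero : zero_module (sub K).
    apply: (tensor_eq0 hR) sd_faithful _ _; first by case: hC.
    move=> c k; apply: (flat_quotient_injective (F := C) iS (Gf 0%N)); rewrite linear0 tensor_mapE.
    pose q : {linear sub S -> M} := fst \o incl S.
    have [|s s0||y yP] := @tensor_right_exact _ C _ _ _ b q _ _ (pure c (i k)).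
    - move=> m'; have [g gP] := g0 (eta M m').
      by exists (to_sub (mkS _ _ (esym gP))).
    - have {}s0 : (incl S s).1 = 0 := s0.
      have [|g gP] := g1 0%N (incl S s).2; first by rewrite -[LHS]SP s0 linear0.
      exists g; apply: (@incl_inj _ _ S); rewrite bP pairlE.
      by rewrite [RHS]surjective_pairing s0; congr (_, _).
    - rewrite tensor_mapE [_ (i k)](congr1 fst (iP k)) -swapE -etaE.
      by rewrite (subP k : eta M (incl K k) = 0) linear0.
    have [|y' y'y] := x1 1%N (swap _ _ y).
      rewrite -[LHS]/(tensor_map (boundary G 0) idfun (swap _ _ y)) -swap_map.
      suff -> : tensor_map idfun (boundary G 0) y = 0 by rewrite linear0.
      pose q0 : {linear sub S -> G 0%N} := snd \o incl S.
      transitivity (tensor_map (idfun : {linear C -> C}) q0 (tensor_map idfun b y)).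
        apply: (tensor_eq (f := tensor_map idfun (boundary G 0))
          (g := tensor_map idfun (snd \o incl S) \o tensor_map idfun b)) => d g.
        rewrite -[RHS]/(tensor_map idfun (snd \o incl S) (tensor_map idfun b (pure d g))).
        by rewrite !tensor_mapE [_ (b g)](congr1 snd (bP g)).
      by rewrite yP tensor_mapE [_ (i k)](congr1 snd (iP k)) pure0r.
    rewrite -[pure _ _]yP -[y](swapK y) -swap_map -y'y.
    rewrite -[boundary _ _ _]/(tensor_map (boundary G 1) idfun y') tensor_map_comp_l.
    rewrite tensor_map_eq0_l ?linear0 // => g.
    apply: (@incl_inj _ _ S); rewrite [LHS]bP pairlE linear0.
    by congr (_, _); exact: boundaryK.
  by have := congr1 (incl K) (Kzero (to_sub (m0 : K m))); rewrite linear0.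
have [h|g gP] := @inj_factor _ _ _ _ (eta M) idfun inj; first by have [m] := surj h; exists m.
by exists g => // m; apply: inj; rewrite gP.
Qed.

Lemma FC_dim_tensor M : proper_dim (FC C) (M ⊗ C)%type = flat_dim M.
Proof.
have iso : bijective (eta M) -> proper_dim (FC C) (M ⊗ C)%type = flat_dim M.
  by move=> eb; rewrite FC_dim_hom /flat_dim; apply/esym/proper_dim_iso; exists (eta M).
by apply: bar_int_eq => n dn; apply: iso;
  [exact: eta_bijective_of_FC_dim dn | exact: eta_bijective_of_flat_dim dn].
Qed.

End Semidualizing.

Theorem proposition5p2 (R : comPzRingType) (C M : lmodType R)
    (hR : noetherian R) (hC : semidualizing C) :
  [/\ (* (a) *)
      forall n : nat,
        (proper_dim (FC C) M <= (n%:Z)%:E)%E <->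
        exists L : augmented M, exact_resolution (FC C) n L,
      (* (b) *)
      proper_dim (FC C) M = flat_dim {linear C -> M}
    & (* (c) *)
      proper_dim (FC C) (C ⊗ M)%type = flat_dim M].
Proof.
split=> [n||]; first exact: FC_dim_le; first exact: FC_dim_hom.
rewrite -(FC_dim_tensor hR hC); apply: proper_dim_iso.
by exists (swap C M); exists (swap M C); exact: swapK.
Qed.
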